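(* For each $p \in \mathbb{C}$ and each non-empty open set $X \subset \mathbb{R}$, the set $$\{\alpha \in X : \overline{\exp \circ \exp (L_\alpha(p))} \neq \mathbb{C}\}$$ has Hausdorff dimension $1$.
   Context: Here $\exp : \mathbb{C} \to \mathbb{C}$, $z \mapsto e^z$, is the complex exponential. For $p \in \mathbb{C}$ and $\alpha \in \mathbb{R}$, $L_\alpha(p) := \{p + t(i+\alpha) : t \in \mathbb{R}\}$ is a (non-horizontal) line through $p$. The overline denotes closure in $\mathbb{C}$. *)

(* Defs.v *)
From mathcomp Require Import all_boot all_order all_algebra.
From mathcomp Require Import all_classical all_reals all_analysis.
From mathcomp Require Export complex.

Set Implicit Arguments.
Unset Strict Implicit.
Unset Printing Implicit Defensive.

Import Order.TTheory GRing.Theory Num.Theory.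
Import numFieldNormedType.Exports.

Local Open Scope classical_set_scope.
Local Open Scope ring_scope.

Section hausdorff_dimension.
Context {R : realType} {V : normedModType R}.
Implicit Types (U A : set V) (s d : R).

Definition diam U : \bar R :=
  ereal_sup [set `|z.1 - z.2|%:E | z in U `*` U].

(* The empty set has weight 0 also for s = 0; its diameter is -oo. *)
Definition diam_pow s U : \bar R :=
  if U == set0 then 0%E else (diam U `^ s)%E.

Definition hausdorff_pre s d A : \bar R :=
  ereal_inf [set (\sum_(0 <= k <oo) diam_pow s (F k))%E | F in
    [set F : nat -> set V | A `<=` \bigcup_k F k /\
       forall k, (diam (F k) <= d%:E)%E]].

(* The supremum over d > 0 is the limit as d tends to 0, by monotonicity in d. *)
Definition hausdorff_measure s A : \bar R :=
  ereal_sup [set hausdorff_pre s d A | d in [set d : R | 0 < d]].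

Definition hausdorff_dim A : \bar R :=
  ereal_inf [set s%:E | s in
    [set s : R | 0 <= s /\ hausdorff_measure s A = 0%E]].

End hausdorff_dimension.

Section complex_exponential.
Context {R : realType}.
Local Open Scope complex_scope.

(* e ^ z, written through its real and imaginary parts. *)
Definition cexp (z : R[i]) : R[i] :=
  (expR (complex.Re z) * cos (complex.Im z)) +i*
  (expR (complex.Re z) * sin (complex.Im z)).

Definition line (alpha : R) (p : R[i]) : set R[i] :=
  [set p + t%:C * ('i + alpha%:C) | t in [set: R]].

End complex_exponential.

(* Main.v *)
Require Import Defs.
From mathcomp Require Import all_boot all_order all_algebra.
From mathcomp Require Import all_classical all_reals all_analysis.
From mathcomp Require Import ring lra.
Import Order.TTheory GRing.Theory Num.Theory.
Import numFieldNormedType.Exports.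
Set Implicit Arguments.
Unset Strict Implicit.
Unset Printing Implicit Defensive.
Local Open Scope classical_set_scope.
Local Open Scope ring_scope.

(** With [p = a + i b], the exponential maps [line al p] to the logarithmic spiral
    of points [exp (a + t al) exp (i (b + t))], and the second exponential turns a
    point [x + i y] of the spiral into a point of modulus [exp x] and argument [y].
    The closure misses a point of the unit circle near -1 as soon as [y] stays away
    from the odd multiples of [pi] whenever [x] is close to 0. For [al > 0] the
    spiral crosses the axis [x = 0] at the heights [y_n] given, up to sign, by
    [exp (a + al (pi / 2 - b + pi n))], and where it is large it comes close to this
    axis only along short arcs, on which [y] hardly differs from the height of the
    crossing ([spiral_near_crossing]). Hence the closure is not the whole plane if
    the [y_n] with [n >= n0] stay away from the odd multiples of [pi]
    ([isolated_point_exists]): the part of the curve coming from the origin of the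
    spiral stays in the right half-plane, and the compact piece in between meets
    the unit circle in a countable set only. Negative slopes are reduced to positive ones by
    complex conjugation.

    There remains to find many slopes for which the [y_n] avoid neighbourhoods of
    the odd multiples of [pi]. Seen as functions of [al], the [y_n] expand like a
    lacunary sequence whose ratio [exp (pi al)] is almost constant for [al] in a
    short interval [[al0, al1]], but may be close to 1. They are therefore treated
    in long blocks of [N]: on an interval where the first function of the block
    varies by a small multiple of [1 / N], the last one varies enough to fit about
    [exp (pi al0 N)] smaller intervals of the same kind, and each function of the
    block spoils only a small proportion of them, so that half of them survive
    ([split_admissible]). The resulting Cantor set is charted by [[0, 1[] through
    expansions in base the number of children, and the inverse of the chart is
    Hoelder of any exponent [s < al0 / al1] once [N] is large
    ([crossing_avoidance_chart]). Pulling coverings back to [[0, 1[] shows that the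
    Hausdorff measure of exponent [s] is positive ([holder_chart_measure_ge]), and
    [s] can be taken as close to 1 as desired by shrinking the interval of slopes.

    The dimension is at most 1 because the line itself has measure zero for every
    exponent [s > 1] ([hausdorff_measure_line_eq0]). *)

(** * Hausdorff measures of subsets of the line *)

Lemma ln_succ_ge (R : realType) (k : nat) :
  k.+2%:R^-1 <= ln k.+2%:R - ln k.+1%:R :> R.
Proof.
rewrite -ln_div ?posrE //.
rewrite -ler_expR lnK ?posrE ?divr_gt0 //.
have := expR_ge1Dx (- (k.+2%:R^-1 : R)).
rewrite expRN => h.
have p1 : 0 < 1 - k.+2%:R^-1 :> R.
  by rewrite subr_gt0 invf_lt1 // ltr1n.
rewrite -[leLHS]invrK.
apply: le_trans (_ : (1 - k.+2%:R^-1)^-1 <= _).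
  by rewrite lef_pV2 ?posrE ?invr_gt0 ?expR_gt0.
rewrite -[k.+2%:R]natr1; have c0 : 0 < k.+1%:R :> R by [].
set c := k.+1%:R in c0 *; rewrite le_eqVlt; apply/orP; left; apply/eqP; field.
by rewrite !gt_eqF // addrK.
Qed.

(** The convexity of [k^-q], read off from [1 + x <= exp x] twice: it lets a
    telescoping sum dominate the series of the [(k + 2)^-(1 + q)]. *)
Lemma powR_step_le (R : realType) (q : R) (k : nat) : 0 < q ->
  q * (k.+2%:R^-1) `^ (1 + q) <= k.+1%:R `^ (- q) - k.+2%:R `^ (- q) :> R.
Proof.
move=> q0.
have E n : n.+1%:R `^ (- q) = expR (- q * ln n.+1%:R) :> R.
  by rewrite /powR pnatr_eq0.
have -> : k.+2%:R^-1 `^ (1 + q) = k.+2%:R^-1 * k.+2%:R `^ (- q) :> R.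
  rewrite powRD ?powRr1 ?invr_ge0 //; last by rewrite invr_eq0 pnatr_eq0 implybT.
  by rewrite -powR_inv1 // -powRrM mulN1r.
have -> : k.+1%:R `^ (- q) = k.+2%:R `^ (- q) * expR (q * (ln k.+2%:R - ln k.+1%:R)) :> R.
  by rewrite !E -expRD; congr expR; lra.
rewrite mulrA [X in X <= _]mulrC -[X in _ - X]mulr1 -mulrBr ler_pM2l ?powR_gt0 //.
apply: le_trans (_ : q * (ln k.+2%:R - ln k.+1%:R) <= _).
  by rewrite ler_pM2l // ln_succ_ge.
by rewrite lerBrDl expR_ge1Dx.
Qed.

Lemma zeta_tail_le (R : realType) (q : R) n : 0 < q ->
  \sum_(0 <= k < n) k.+2%:R^-1 `^ (1 + q) <= q^-1 :> R.
Proof.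
move=> q0; rewrite -[leRHS]mul1r ler_pdivlMr // mulrC mulr_sumr.
apply: (@le_trans _ _ (\sum_(0 <= k < n)
    (- k.+2%:R `^ (- q) - - k.+1%:R `^ (- q)))).
  by apply: ler_sum => k _; rewrite opprK [leRHS]addrC powR_step_le.
rewrite (telescope_sumr (fun k => - (k.+1%:R `^ (- q)))) // powR1 opprK.
by rewrite gerDr oppr_le0 powR_ge0.
Qed.

Lemma ln_succ_le (R : realType) (k : nat) : ln k.+2%:R - ln k.+1%:R <= k.+1%:R^-1 :> R.
Proof.
rewrite -ln_div ?posrE // -ler_expR lnK ?posrE ?divr_gt0 //.
apply: le_trans (expR_ge1Dx _).
by rewrite -[k.+2%:R]natr1 mulrDl divff ?pnatr_eq0 // mul1r.
Qed.

Lemma diam_itv_le (R : realType) (a b c : R) : b - a <= c ->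
  (diam (`[a, b] : set R) <= c%:E)%E.
Proof.
move=> abc; apply: ge_ereal_sup => _ [[x y] [/= xab yab] <-].
move: xab yab; rewrite !in_itv /= => /andP[x1 x2] /andP[y1 y2].
by rewrite lee_fin ler_norml; lra.
Qed.

Lemma diam_pow_le (R : realType) (s c : R) (U : set R) : 0 <= s ->
  (diam U <= c%:E)%E -> (diam_pow s U <= (c `^ s)%:E)%E.
Proof.
move=> s0 Uc; rewrite /diam_pow; case: ifPn => [_|/set0P[x Ux]].
  by rewrite lee_fin powR_ge0.
have U0 : (0 <= diam U)%E.
  by apply: ereal_sup_ubound; exists (x, x) => //=; rewrite subrr normr0.
rewrite -poweR_EFin; apply: gt0_ler_poweR => //.
- by rewrite in_itv /= U0 leey.
- by rewrite in_itv /= (le_trans U0 Uc) leey.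
Qed.

Lemma hausdorff_pre_ge0 (R : realType) (s d : R) (A : set R) :
  (0 <= hausdorff_pre s d A)%E.
Proof.
apply: le_ereal_inf_tmp => _ [F _ <-]; apply: nneseries_ge0 => k _ _.
by rewrite /diam_pow; case: ifP => // _; exact: poweR_ge0.
Qed.

(** Intervals of harmonic length suffice: their lengths have an infinite sum, so
    that they cover the line, whereas the powers of exponent [1 + q > 1] of the
    lengths are summable. Taking multiples of the logarithms of the integers as
    endpoints makes the interval containing a given point explicit. Both
    half-lines are covered at once, the interval of rank [k] having the index
    [k./2] on the side given by the parity of [k]; this halving of the rank is
    paid for by the factor 4. *)
Lemma hausdorff_pre_line_le (R : realType) (q d eta : R) (A : set R) :
  0 < q -> 0 < eta -> 2 * eta <= d -> 4 * eta <= 1 ->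
  (hausdorff_pre (1 + q) d A <= (4 * eta / q)%:E)%E.
Proof.
move=> q0 eta0 etad eta1.
pose x i : R := eta * ln i.+1%:R.
pose F k : set R := if odd k then `[- x k./2.+1, - x k./2]%classic
                    else `[x k./2, x k./2.+1]%classic.
have Fdiam k : (diam (F k) <= (4 * eta * k.+2%:R^-1)%:E)%E.
  have step : x k./2.+1 - x k./2 <= 4 * eta * k.+2%:R^-1.
    rewrite /x -mulrBr [4 * eta]mulrC -mulrA ler_pM2l //.
    rewrite (le_trans (ln_succ_le _ _)) // ler_pdivlMr // mulrC ler_pdivrMr //.
    rewrite -natrM ler_nat -{1}(odd_double_half k) -mul2n.
    case: (odd k) => /=; rewrite ?add0n ?add1n mulnS.
      by rewrite -addn3 addnC leq_add // leq_mul.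
    by rewrite -addn2 addnC leq_add // leq_mul.
  by rewrite /F; case: ifP => _; apply: diam_itv_le; rewrite // opprK addrC.
apply: ge_ereal_inf; exists (\sum_(0 <= k <oo) diam_pow (1 + q) (F k))%E.
  exists F => //; split => [z _|k].
    pose y := expR (`|z| / eta).
    have y1 : 1 <= y by rewrite -expR0 ler_expR divr_ge0 // ltW.
    have /andP[lo hi] := truncn_itv (le_trans ler01 y1).
    have [i iE] : exists i, Num.truncn y = i.+1.
      by exists (Num.truncn y).-1; rewrite prednK // truncn_gt0.
    rewrite iE in lo hi.
    have z1 : x i <= `|z|.
      by rewrite /x mulrC -ler_pdivlMr // -ler_expR lnK ?posrE.
    have z2 : `|z| <= x i.+1.
      by rewrite /x mulrC -ler_pdivrMr // -ler_expR lnK ?posrE // ltW.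
    case: (leP 0 z) => z0.
      rewrite ger0_norm // in z1 z2.
      by exists i.*2 => //; rewrite /F odd_double doubleK /= in_itv /= z1.
    rewrite ltr0_norm // in z1 z2.
    exists i.*2.+1 => //; rewrite /F /= odd_double /= uphalf_double in_itv /=.
    by apply/andP; split; lra.
  apply: le_trans (Fdiam k) _; rewrite lee_fin (le_trans _ etad) //.
  rewrite ler_pdivrMr // (_ : 4 * eta = 2 * eta * 2); last by lra.
  by rewrite ler_pM2l ?mulr_gt0 // ler_nat.
have s0 : 0 <= 1 + q by lra.
apply: lime_le.
  by apply: is_cvg_nneseries => k _ _; rewrite /diam_pow; case: ifP => // _; exact: poweR_ge0.
apply: nearW => n.
apply: (@le_trans _ _ (\sum_(0 <= k < n) ((4 * eta) `^ (1 + q) * k.+2%:R^-1 `^ (1 + q))%:E)%E).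
  apply: lee_sum => k _; rewrite -powRM ?invr_ge0 ?mulr_ge0 ?(ltW eta0) //.
  exact: diam_pow_le.
rewrite sumEFin lee_fin -mulr_sumr.
apply: ler_pM; rewrite ?powR_ge0 //.
- by apply: sumr_ge0 => k _; exact: powR_ge0.
- by apply: ge1r_powR; [rewrite mulr_gt0|lra].
- exact: zeta_tail_le.
Qed.

Lemma hausdorff_measure_line_eq0 (R : realType) (s : R) (A : set R) : 1 < s ->
  hausdorff_measure s A = 0%E.
Proof.
move=> s1; have q0 : 0 < s - 1 by lra.
have sE : s = 1 + (s - 1) by lra.
have pre0 d : 0 < d -> hausdorff_pre s d A = 0%E.
  move=> d0; apply/eqP; rewrite eq_le hausdorff_pre_ge0 andbT.
  apply/lee_addgt0Pr => e e0; rewrite add0e sE.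
  pose eta := Num.min (Num.min (d / 2) (1 / 4)) (e * (s - 1) / 4).
  have h1 : eta <= d / 2 by rewrite !ge_min lexx.
  have h2 : eta <= 1 / 4 by rewrite !ge_min lexx orbT.
  have h3 : eta <= e * (s - 1) / 4 by rewrite !ge_min lexx orbT.
  have eta0 : 0 < eta by rewrite !lt_min !divr_gt0 ?mulr_gt0.
  apply: le_trans (hausdorff_pre_line_le _ q0 eta0 _ _) _; [lra|lra|].
  by rewrite lee_fin ler_pdivrMr //; lra.
apply/eqP; rewrite eq_le; apply/andP; split.
  by apply: ge_ereal_sup => _ [d d0 <-]; rewrite pre0.
by apply: ereal_sup_ubound; exists 1; [exact: ltr01|exact: pre0].
Qed.

(** A chart [g] whose inverse is Hoelder of exponent [s] pulls a covering of [A]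
    back to a covering of [[0, 1[] by sets whose lengths are at most [2 C] times
    the powers of exponent [s] of the diameters; the countable subadditivity of
    the Lebesgue measure then bounds the sum of these powers from below. *)
Lemma holder_chart_measure_ge (R : realType) (s C : R) (A : set R) (g : R -> R) :
  0 <= s -> 0 < C ->
  (forall u, 0 <= u < 1 -> A (g u)) ->
  (forall u v, 0 <= u < 1 -> 0 <= v < 1 -> `|u - v| <= C * `|g u - g v| `^ s) ->
  ((2 * C)^-1%:E <= hausdorff_measure s A)%E.
Proof.
move=> s0 C0 gA gC; apply: (@le_trans _ _ (hausdorff_pre s 1 A)); last first.
  by apply: ereal_sup_ubound; exists 1 => //=; exact: ltr01.
apply: le_ereal_inf_tmp => _ [F [AF Fd] <-].
have dge0 k : (0 <= diam_pow s (F k))%E.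
  by rewrite /diam_pow; case: ifP => // _; exact: poweR_ge0.
pose I01 : set R := `[0, 1[%classic.
(* [B] is the interval centred at a point that the chart sends into [F k]. *)
have piece k : exists B : set R, [/\ measurable B,
    (lebesgue_measure B <= (2 * C)%:E * diam_pow s (F k))%E &
    forall u, I01 u -> F k (g u) -> B u].
  case: (pselect (exists u, I01 u /\ F k (g u))) => [[u [u01 Fu]]|nou]; last first.
    exists set0; split => //; first by rewrite measure0 mule_ge0 // lee_fin mulr_ge0 // ltW.
    by move=> u u01 Fu; case: nou; exists u.
  have dist v : F k (g v) -> (`|g u - g v|%:E <= diam (F k))%E.
    by move=> Fv; apply: ereal_sup_ubound; exists (g u, g v).
  have [d dE] : exists d : R, diam (F k) = d%:E.
    have := Fd k; have := dist u Fu; case: (diam (F k)) => [d _ _||] //.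
    by exists d.
  have d0 : 0 <= d by have := dist u Fu; rewrite dE subrr normr0 lee_fin.
  have dpE : diam_pow s (F k) = (d `^ s)%:E.
    rewrite /diam_pow ifF ?dE ?poweR_EFin //.
    by apply/eqP => F0; rewrite F0 in Fu.
  pose w := C * d `^ s.
  have w0 : 0 <= w by rewrite mulr_ge0 ?powR_ge0 // ltW.
  exists `[u - w, u + w]%classic; split => //.
    rewrite lebesgue_measure_itv /= dpE; case: ifP => _; last first.
      by rewrite mule_ge0 // lee_fin ?powR_ge0 // mulr_ge0 // ltW.
    by rewrite -EFinB -EFinM lee_fin /w; lra.
  move=> v v01 Fv; rewrite /= in_itv /= -ler_distlC.
  have Hu : 0 <= u < 1 by move: u01; rewrite /I01 /= in_itv.
  have Hv : 0 <= v < 1 by move: v01; rewrite /I01 /= in_itv.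
  apply: le_trans (gC _ _ Hu Hv) _; rewrite ler_pM2l //.
  apply: ge0_ler_powR => //; rewrite ?nnegrE //.
  by have := dist v Fv; rewrite dE lee_fin.
have {piece}[B BP] := choice piece.
have le1 : (1 <= (2 * C)%:E * \sum_(0 <= k <oo) diam_pow s (F k))%E.
  rewrite -nneseriesZl; last by move=> *; exact: dge0.
  have -> : (1 = lebesgue_measure I01)%E.
    by rewrite lebesgue_measure_itv /= lte_fin ltr01 oppr0 adde0.
  have sub : (lebesgue_measure I01 <= \sum_(0 <= k <oo) lebesgue_measure (B k))%E.
    apply: measure_sigma_subadditive; first by move=> k; have [] := BP k.
      exact: measurable_itv.
    move=> u u01; have [|k _ Fk] := AF (g u).
      by apply: gA; move: u01; rewrite /I01 /= in_itv.
    by exists k => //; have [_ _] := BP k; apply.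
  by apply: le_trans sub _; apply: lee_nneseries => [//|k _]; have [] := BP k.
have C2 : 0 < 2 * C by lra.
rewrite -(@lee_pmul2l _ (2 * C)%:E) ?lte_fin //.
by rewrite -EFinM divff ?gt_eqF.
Qed.

(** * Charts of Cantor sets *)

Section digit_scheme.
Context {R : realType}.
Variables (M : nat) (M1 : (1 < M)%N).
Implicit Types u v : R.

Definition radix_prefix u j := Num.truncn (u * M%:R ^+ j).

Definition radix_digit u j := (radix_prefix u j.+1 - M * radix_prefix u j)%N.

Lemma radix_prefixP u j : 0 <= u ->
  (radix_prefix u j)%:R <= u * M%:R ^+ j < (radix_prefix u j).+1%:R.
Proof.
by move=> u0; apply: truncn_itv; rewrite mulr_ge0 // exprn_ge0.
Qed.

Lemma radix_prefixS u j : 0 <= u ->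
  (M * radix_prefix u j <= radix_prefix u j.+1 < M * (radix_prefix u j).+1)%N.
Proof.
move=> u0; have /andP[lo hi] := radix_prefixP j u0.
have M0 : 0 < M%:R :> R by rewrite ltr0n ltnW.
have uM0 : 0 <= u * M%:R ^+ j.+1 by rewrite mulr_ge0 // exprn_ge0.
rewrite /radix_prefix truncn_ge_nat // truncn_lt_nat // !natrM exprS.
by rewrite mulrCA ler_pM2l // ltr_pM2l // lo.
Qed.

Lemma radix_digit_lt u j : 0 <= u -> (radix_digit u j < M)%N.
Proof.
move=> /(radix_prefixS j)/andP[lo hi].
by rewrite /radix_digit ltn_subLR // -mulnSr.
Qed.

Lemma radix_prefix0 u : 0 <= u < 1 -> radix_prefix u 0 = 0%N.
Proof.
by move=> u01; apply: truncn_def; rewrite expr0 mulr1.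
Qed.

(** The distance is compared with the rank of the first differing digit, and not
    the other way round: points such as 0.0999 and 0.1000 are much closer than
    that rank suggests, which is harmless, as a scheme only needs points with
    different digits to be sent far apart. *)
Lemma radix_first_difference u v : 0 <= u < 1 -> 0 <= v < 1 -> u != v ->
  exists j, [/\ forall i, (i < j)%N -> radix_digit u i = radix_digit v i,
    radix_digit u j <> radix_digit v j & `|u - v| <= (M%:R ^+ j)^-1].
Proof.
move=> u01 v01 uv; have /andP[u0 _] := u01; have /andP[v0 _] := v01.
have M0 : 0 < M%:R :> R by rewrite ltr0n ltnW.
have close j : radix_prefix u j = radix_prefix v j -> `|u - v| <= (M%:R ^+ j)^-1.
  move=> e; have /andP[] := radix_prefixP j u0; have /andP[] := radix_prefixP j v0.
  rewrite e => v1 v2 u1 u2; rewrite -[leRHS]mul1r ler_pdivlMr ?exprn_gt0 //.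
  rewrite -(ger0_norm (exprn_ge0 j (ltW M0))) -normrM mulrBl ler_norml.
  by move: v2 u2; rewrite -!natr1; lra.
have ex : exists j, radix_prefix u j != radix_prefix v j.
  apply: contrapT => /forallNP same.
  have uv0 : 0 < `|u - v| by rewrite normr_gt0 subr_eq0.
  pose j := (Num.truncn `|u - v|^-1).+1.
  have /negP/negPn/eqP/close := same j; apply/negP; rewrite -ltNge.
  apply: lt_le_trans (_ : j%:R^-1 <= _).
    by rewrite ltf_pV2 ?posrE ?ltr0n ?exprn_gt0 // -natrX ltr_nat ltn_expl.
  rewrite -[leRHS]invrK lef_pV2 ?posrE ?invr_gt0 // ?ltr0n //.
  exact/ltW/truncnS_gt.

move: (ex_minnP ex) => [[|j] dj min].
  by rewrite !radix_prefix0 ?eqxx in dj.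
have eqi i : (i <= j)%N -> radix_prefix u i = radix_prefix v i.
  by move=> ij; apply/eqP; apply: contraTT ij => /min; rewrite -ltnNge.
exists j; split; last exact: close (eqi _ _).
  by move=> i ij; rewrite /radix_digit !eqi // ltnW.
move=> dd; case/eqP: dj.
have /andP[lu _] := radix_prefixS j u0; have /andP[lv _] := radix_prefixS j v0.
by rewrite -(subnK lu) -(subnK lv) -/(radix_digit u j) dd eqi.
Qed.

Lemma nested_intervals_point (I : nat -> R * R) :
  (forall j, (I j).1 <= (I j).2) ->
  (forall j, (I j).1 <= (I j.+1).1 /\ (I j.+1).2 <= (I j).2) ->
  exists x, forall j, (I j).1 <= x <= (I j).2.
Proof.
move=> le12 nest.
have inc m n : (m <= n)%N -> (I m).1 <= (I n).1 /\ (I n).2 <= (I m).2.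
  elim: n => [|n IH]; first by rewrite leqn0 => /eqP ->.
  rewrite leq_eqVlt => /predU1P[-> //|/IH[l r]].
  by have [l' r'] := nest n; split; [exact: le_trans l l'|exact: le_trans r' r].
have cross m n : (I m).1 <= (I n).2.
  case: (leqP m n) => [mn|/ltnW nm].
    exact: le_trans (inc _ _ mn).1 (le12 n).
  exact: le_trans (le12 m) (inc _ _ nm).2.
pose S := [set (I j).1 | j in [set: nat]].
have Sub n : ubound S (I n).2 by move=> _ [m _ <-].
have S0 : S !=set0 by exists (I 0%N).1, 0%N.
exists (sup S) => j; apply/andP; split; last exact: ge_sup.
by apply: ub_le_sup; [exists (I 0%N).2|exists j].
Qed.

(** The chart sends [u] to the point reached in the tree of cells by following
    the digits of [u]. Two points part at their first differing digit, and from
    there on they stay in disjoint cells of a common parent. *)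
Lemma cantor_scheme (St : nat -> R * R -> Prop) (gap : nat -> R) (I0 : R * R) :
  St 0%N I0 ->
  (forall j I, St j I -> I.1 <= I.2) ->
  (forall j I, St j I -> exists J : nat -> R * R,
    (forall i, (i < M)%N ->
       [/\ St j.+1 (J i), I.1 <= (J i).1 & (J i).2 <= I.2]) /\
    (forall i k, (i < M)%N -> (k < M)%N -> i <> k -> forall x y,
       (J i).1 <= x <= (J i).2 -> (J k).1 <= y <= (J k).2 ->
       gap j <= `|x - y|)) ->
  exists g : R -> R,
    (forall u, 0 <= u < 1 -> exists I : nat -> R * R, forall j,
       St j (I j) /\ (I j).1 <= g u <= (I j).2) /\
    (forall u v, 0 <= u < 1 -> 0 <= v < 1 -> u != v ->
       exists j, `|u - v| <= (M%:R ^+ j)^-1 /\ gap j <= `|g u - g v|).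
Proof.
move=> St0 Stle split_cell.
have /choice[child childP] : forall jI : nat * (R * R), exists J : nat -> R * R,
    St jI.1 jI.2 ->
    (forall i, (i < M)%N ->
       [/\ St jI.1.+1 (J i), jI.2.1 <= (J i).1 & (J i).2 <= jI.2.2]) /\
    (forall i k, (i < M)%N -> (k < M)%N -> i <> k -> forall x y,
       (J i).1 <= x <= (J i).2 -> (J k).1 <= y <= (J k).2 ->
       gap jI.1 <= `|x - y|).
  move=> [j I]; case: (pselect (St j I)) => [/split_cell[J HJ]|nSt].
    by exists J.
  by exists (fun=> I).
pose fix cell (u : R) (j : nat) : R * R :=
  if j is k.+1 then child (k, cell u k) (radix_digit u k) else I0.
have cellSt u j : 0 <= u -> St j (cell u j).
  move=> u0; elim: j => [//|j IH] /=.
  by have [/(_ _ (radix_digit_lt j u0))[]] := childP (j, cell u j) IH.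
have nest u j : 0 <= u ->
    (cell u j).1 <= (cell u j.+1).1 /\ (cell u j.+1).2 <= (cell u j).2.
  move=> u0; have [/(_ _ (radix_digit_lt j u0))[]] :=
    childP (j, cell u j) (cellSt u j u0).
  by [].
have /choice[g gP] : forall u, exists x, 0 <= u ->
    forall j, (cell u j).1 <= x <= (cell u j).2.
  move=> u; case: (pselect (0 <= u)) => u0; last by exists 0.
  have [|j|x xP] := @nested_intervals_point (cell u).
  - by move=> j; apply: Stle (cellSt u j u0).
  - exact: nest.
  - by exists x.
exists g; split => [u /andP[u0 _]|u v u01 v01 uv].
  by exists (cell u) => j; split; [exact: cellSt|exact: gP].
have /andP[u0 _] := u01; have /andP[v0 _] := v01.
have [j [same differ close]] := radix_first_difference u01 v01 uv.
exists j; split=> //.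
have cellE i : (i <= j)%N -> cell u i = cell v i.
  by elim: i => [//|i IH] ij /=; rewrite IH ?same // ltnW.
have [_ sep] := childP (j, cell u j) (cellSt u j u0).
apply: sep (radix_digit_lt j u0) (radix_digit_lt j v0) differ _ _ _ _.
  exact: gP u0 j.+1.
by rewrite cellE //; exact: gP v0 j.+1.
Qed.

End digit_scheme.

(** * Lacunary families avoiding the integers *)

Lemma powR_exprV (R : realType) (x s : R) n : 0 < x ->
  (x ^+ n)^-1 `^ s = ((x `^ s) ^+ n)^-1.
Proof.
move=> x0; elim: n => [|n IH]; first by rewrite !expr0 invr1 powR1.
rewrite !exprS !invfM powRM ?invr_ge0 ?exprn_ge0 ?(ltW x0) // IH.
by rewrite -[x^-1]powR_inv1 ?(ltW x0) // -powRrM mulN1r powRN.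
Qed.

Lemma card_le_injective_in (K q : nat) (B : {set 'I_K}) (f : 'I_K -> nat) :
  {in B, forall i, (f i < q)%N} -> {in B &, injective f} -> (#|B| <= q)%N.
Proof.
move=> fq finj; rewrite cardE -(size_map f) -(size_iota 0 q).
apply: uniq_leq_size.
  by rewrite map_inj_in_uniq ?enum_uniq // => i k; rewrite !mem_enum; exact: finj.
by move=> _ /mapP [i + ->]; rewrite mem_enum mem_iota => /fq.
Qed.

(** A union bound: [N] sets of at most [q] elements leave room for [M] others. *)
Lemma enumerate_outside_small_sets (K N q M : nat) (B : 'I_N -> {set 'I_K}) :
  (0 < M)%N -> (forall d, #|B d| <= q)%N -> (N * q + M <= K)%N ->
  exists e : nat -> 'I_K,
    [/\ forall i d, (i < M)%N -> e i \notin B d &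
     forall i k, (i < M)%N -> (k < M)%N -> e i = e k -> i = k].
Proof.
move=> M0 Bq NqM; have K0 : (0 < K)%N by apply: leq_trans NqM; rewrite addn_gt0 M0 orbT.
pose G := ~: \bigcup_d B d.
have cB : (#|(\bigcup_d B d)%SET| <= N * q)%N.
  have -> : (N * q = \sum_(d < N) q)%N by rewrite sum_nat_const card_ord.
  elim/big_ind2 : _ => [|x1 n1 x2 n2 h1 h2|d _]; first by rewrite cards0.
    by apply: leq_trans (leq_add h1 h2); exact: leq_card_setU.
  exact: Bq.
have MG : (M <= size (enum G))%N.
  rewrite -cardE -(leq_add2l (N * q)%N) (leq_trans NqM) //.
  have := cardsC (\bigcup_d B d)%SET; rewrite -/G card_ord => GK.
  by rewrite -[leqLHS]GK leq_add2r.
exists (nth (Ordinal K0) (enum G)); split => [i d iM|i k iM kM].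
  have : nth (Ordinal K0) (enum G) i \in G.
    by rewrite -mem_enum mem_nth // (leq_trans iM).
  rewrite finset.in_setC; apply: contra => id.
  by apply/finset.bigcupP; exists d.
by move/eqP; rewrite nth_uniq ?enum_uniq ?(leq_trans _ MG) // => /eqP.
Qed.

Lemma double_ltn i k : (i < k)%N -> ((2 * i).+1 < 2 * k)%N.
Proof. by move=> ik; rewrite (@leq_trans (2 * i.+1)) ?leq_pmul2l // mulnS. Qed.

(** In this section a family of increasing functions expands like a lacunary
    sequence, and the set of points whose images all keep a fixed distance from
    the integers is bounded from below. The functions are handled in blocks of
    [N]: [grow_block] makes the last function of a block vary enough on a cell to
    contain many smaller cells, [grow_ge1] bounds the variation of the others by
    that of the last one, and [grow_le] bounds both the number of cells that an
    integer can spoil and the contraction from one level to the next. *)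
Section avoid_integers.
Context {R : realType}.
Variables (F : nat -> R -> R) (x0 y0 : R) (N m : nat) (rho : R).
Hypotheses (N0 : (0 < N)%N) (m2 : (2 <= m)%N) (rho1 : 1 <= rho).
Hypothesis cont : forall n, continuous (F n).
Hypothesis mono : forall n u v, x0 <= u -> u <= v -> v <= y0 -> F n u <= F n v.
Hypothesis grow_ge1 : forall n d u v, (d <= N)%N -> x0 <= u -> u <= v -> v <= y0 ->
  F n v - F n u <= F (n + d)%N v - F (n + d)%N u.
Hypothesis grow_block : forall n u v, x0 <= u -> u <= v -> v <= y0 ->
  (8 * N * m)%:R * (F n v - F n u) <= F (n + N)%N v - F (n + N)%N u.
Hypothesis grow_le : forall n d u v, (d <= N)%N -> x0 <= u -> u <= v -> v <= y0 ->
  F (n + d)%N v - F (n + d)%N u <= rho * (F n v - F n u).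

(** A cell is an interval on which the function opening a block varies by at
    least this amount. The value is such that [4 N m] cells, each followed by a
    gap of the same span, are spread over a variation of exactly [m]: each
    function of the block can then be close to at most [m + 2] integers, so that
    the [N] of them spoil at most half of the cells. *)
Definition cell_span : R := (8 * N)%:R^-1.

(** Distinct candidate cells are [cell_span] apart for the last function of a
    block, hence [cell_span / rho] apart for the others: with half of that as a
    radius, no integer can spoil two cells. *)
Definition avoid_radius : R := cell_span / (2 * rho).

Definition avoids_integers n z := forall l : int, avoid_radius <= `|F n z - l%:~R|.

Definition hits_integer n (I : R * R) :=
  exists z (l : int), I.1 <= z <= I.2 /\ `|F n z - l%:~R| < avoid_radius.

Definition admissible j (I : R * R) :=
  [/\ x0 <= I.1, I.1 <= I.2, I.2 <= y0,
      cell_span <= F (j * N)%N I.2 - F (j * N)%N I.1 &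
      forall n z, (n < j * N)%N -> I.1 <= z <= I.2 -> avoids_integers n z].

Let D0 : 0 < cell_span. Proof. by rewrite invr_gt0 ltr0n muln_gt0. Qed.

Let rho0 : 0 < rho. Proof. exact: lt_le_trans ltr01 rho1. Qed.

Let mono_lt n u v : x0 <= u -> v <= y0 -> x0 <= v -> u <= y0 -> F n u < F n v -> u <= v.
Proof.
move=> xu vy xv uy; rewrite leNgt; apply: contraTN => /ltW vu.
by rewrite -leNgt mono.
Qed.

Let D8 : (8 * N * m)%:R * cell_span = m%:R.
Proof.
by rewrite /cell_span natrM mulrAC divff ?mul1r // pnatr_eq0 -lt0n muln_gt0.
Qed.

Let radius_lt : 2 * avoid_radius <= cell_span / rho.
Proof. by rewrite /avoid_radius invfM; lra. Qed.

Let radius_half : avoid_radius <= 1 / 2.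
Proof.
have : cell_span / rho <= 1.
  rewrite ler_pdivrMr // mul1r (le_trans _ rho1) // /cell_span invf_le1 ?ltr0n ?muln_gt0 //.
  by rewrite ler1n muln_gt0.
by move: radius_lt; lra.
Qed.

(** [4 N m] equally spaced cells, as seen through the last function of the
    block; consecutive ones are one cell apart. *)
Definition candidate_cells j (I : R * R) (J : nat -> R * R) :=
  forall i, (i < 4 * N * m)%N ->
    [/\ I.1 <= (J i).1, (J i).1 <= (J i).2, (J i).2 <= I.2,
        F (j.+1 * N)%N (J i).1 = F (j.+1 * N)%N I.1 + (2 * i)%:R * cell_span &
        F (j.+1 * N)%N (J i).2 = F (j.+1 * N)%N I.1 + (2 * i).+1%:R * cell_span].

Let candidates j I : admissible j I ->
  exists J : nat -> R * R, candidate_cells j I J.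
Proof.
case: I => a b [/= xa ab by0 span _].
set h := F (j.+1 * N)%N.
have V : m%:R <= h b - h a.
  rewrite /h mulSnr; apply: le_trans (grow_block _ xa ab by0).
  by rewrite -D8 ler_wpM2l.
have pre i : (i <= 8 * N * m)%N ->
    exists z, (a <= z <= b) /\ h z = h a + i%:R * cell_span.
  move=> iK; have iD : 0 <= i%:R * cell_span <= m%:R.
    by rewrite mulr_ge0 ?(ltW D0) //= -D8 ler_wpM2r ?ler_nat ?(ltW D0).
  have [||z zab hz] := @IVT _ h a b (h a + i%:R * cell_span) ab.
  - exact/continuous_subspaceT/cont.
  - by rewrite ge_min le_max; apply/andP; split; apply/orP; [left|right]; lra.
  by exists z; move: zab; rewrite in_itv.
have /choice[J JP] : forall i, exists xy : R * R, (i < 4 * N * m)%N ->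
    [/\ a <= xy.1 <= b, a <= xy.2 <= b, h xy.1 = h a + (2 * i)%:R * cell_span
      & h xy.2 = h a + (2 * i).+1%:R * cell_span].
  move=> i; case: (ltnP i (4 * N * m)) => iK; last by exists (a, b).
  have iK' : ((2 * i).+1 < 8 * N * m)%N.
    have -> : (8 * N * m = 2 * (4 * N * m))%N by rewrite !mulnA.
    exact: double_ltn.
  have [z1 [? ?]] := pre _ (ltnW (ltnW iK')); have [z2 [? ?]] := pre _ (ltnW iK').
  by exists (z1, z2).
exists J => i iK; have [/andP[a1 b1] /andP[a2 b2] h1 h2] := JP i iK; split => //.
apply: (@mono_lt (j.+1 * N)%N); rewrite ?(le_trans xa) ?(le_trans _ by0) //.
by rewrite -/h h1 h2 ltrD2l ltr_pM2r // ltr_nat.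
Qed.

Let candidates_apart j I J : admissible j I ->
  candidate_cells j I J ->
  forall i k, (i < k)%N -> (k < 4 * N * m)%N -> forall u v,
    (J i).1 <= u <= (J i).2 -> (J k).1 <= v <= (J k).2 ->
    u <= v /\ cell_span <= F (j.+1 * N)%N v - F (j.+1 * N)%N u.
Proof.
case=> [xa ab by0 _ _] JP i k ik kK u v /andP[u1 u2] /andP[v1 v2].
have [a1 i12 b1 hi1 hi2] := JP i (ltn_trans ik kK).
have [a2 k12 b2 hk1 hk2] := JP k kK.
set h := F (j.+1 * N)%N in hi1 hi2 hk1 hk2 *.
have xi2 : x0 <= (J i).2 by rewrite (le_trans xa) ?(le_trans a1).
have k1y : (J k).1 <= y0 by rewrite (le_trans k12) // (le_trans b2).
have sep : cell_span <= h (J k).1 - h (J i).2.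
  rewrite hi2 hk1 opprD addrACA subrr add0r -mulrBl ler_peMl ?(ltW D0) //.
  by rewrite lerBrDr nat1r ler_nat double_ltn.
have ik21 : (J i).2 <= (J k).1.
  apply: (@mono_lt (j.+1 * N)%N); rewrite ?(le_trans xa a2) ?(le_trans b1 by0) //.
  by rewrite -subr_gt0 (lt_le_trans D0 sep).
have uv : u <= v by rewrite (le_trans u2) // (le_trans ik21).
split=> //.
have hu : h u <= h (J i).2 by apply: mono; lra.
have hv : h (J k).1 <= h v by apply: mono; lra.
by move: sep hu hv; lra.
Qed.

(** Each bad candidate claims an integer close to which the function comes; by the
    choice of [avoid_radius] no integer is claimed twice, and over the whole range
    of the candidates the function varies by at most [m]. *)
Let bad_candidates_le j I (J : nat -> R * R) d : admissible j I -> (d < N)%N ->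
  candidate_cells j I J ->
  (#|[set i : 'I_(4 * N * m) | `[< hits_integer (j * N + d) (J i) >]]%SET| <= m + 2)%N.
Proof.
move=> adm dN JP; set B := [set i | _]%SET.
have /choice[zl zlP] : forall i : 'I_(4 * N * m), exists zl : R * int, i \in B ->
    (J i).1 <= zl.1 <= (J i).2 /\
    `|F (j * N + d)%N zl.1 - zl.2%:~R| < avoid_radius.
  move=> i; case: (boolP (i \in B)) => [|_]; last by exists (0, 0).
  by rewrite inE => /asboolP[z [l zlP]]; exists (z, l).
have [xa ab by0 _ _] := adm.
set a := I.1 in xa ab JP; set g := F (j * N + d)%N in zlP.
(* The claimed integers are numbered from [e] on. *)
pose e := Num.floor (g a - avoid_radius).
have gz z i : (i < 4 * N * m)%N -> (J i).1 <= z <= (J i).2 ->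
    g a <= g z <= g a + m%:R.
  move=> iK /andP[z1 z2]; have [a1 _ b2 h1 h2] := JP i iK.
  have az : a <= z by rewrite (le_trans a1).
  have zy : z <= y0 by rewrite (le_trans z2) ?(le_trans b2).
  rewrite mono //=.
  have := grow_ge1 (j * N + d)%N (leq_subr d N) xa az zy.
  rewrite -addnA subnKC ?(ltnW dN) // -mulSnr -/g.
  have : F (j.+1 * N)%N z <= F (j.+1 * N)%N (J i).2.
    by apply: mono; rewrite ?(le_trans xa az) ?(le_trans b2).
  have : (2 * i).+1%:R * cell_span <= m%:R.
    rewrite -D8 ler_wpM2r ?(ltW D0) // ler_nat.
    by rewrite -[8%N]/(2 * 4)%N -!mulnA ltnW // double_ltn // mulnA.
  by rewrite h2; lra.
have le_l i : i \in B -> 0 <= (zl i).2 - e < (m + 2)%:Z.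
  move=> iB; have [zi near_l] := zlP i iB.
  have /andP[ga gm] := gz _ _ (ltn_ord i) zi.
  have /andP[e1 e2] := floor_itv (g a - avoid_radius).
  move: near_l; rewrite ltr_distl => /andP[n1 n2].
  have m2E : ((m + 2)%:Z)%:~R = m%:R + 2 :> R by rewrite -natrD.
  rewrite -(ler_int R) -(ltr_int R) m2E rmorphB /=.
  by move: e2; rewrite rmorphD /= -/e; move: e1; rewrite -/e; move: radius_half; lra.
apply: (@card_le_injective_in _ _ _ (fun i => `|(zl i).2 - e|%N)).
  by move=> i /le_l/andP[l0 lm]; rewrite -ltz_nat gez0_abs.
have clash (i k : 'I_(4 * N * m)) : (i < k)%N -> i \in B -> k \in B -> (zl i).2 <> (zl k).2.
  move=> ik iB kB lE; have [zi ni] := zlP i iB; have [zk nk] := zlP k kB.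
  have [zik spread] := candidates_apart adm JP ik (ltn_ord k) zi zk.
  have [a1 _ _ _ _] := JP i (ltn_ord i); have [_ _ b2 _ _] := JP k (ltn_ord k).
  have /andP[zi1 _] := zi; have /andP[_ zk2] := zk.
  have xz : x0 <= (zl i).1 by rewrite (le_trans xa) ?(le_trans a1).
  have zy : (zl k).1 <= y0 by rewrite (le_trans zk2) ?(le_trans b2).
  have := grow_le (j * N + d)%N (leq_subr d N) xz zik zy.
  rewrite -addnA subnKC ?(ltnW dN) // -mulSnr -/g => le_rho.
  have := le_trans spread le_rho; rewrite mulrC -ler_pdivrMr //.
  move: ni nk; rewrite lE !ltr_distl => /andP[n1 n2] /andP[n3 n4].
  by move: radius_lt; lra.
move=> i k iB kB /(congr1 Posz); rewrite !gez0_abs; last 2 first.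
- by have /andP[] := le_l k kB.
- by have /andP[] := le_l i iB.
move=> /addIr lE; case: (ltngtP i k) => [ik|ki|/val_inj //].
  by case: (clash _ _ ik iB kB).
by case: (clash _ _ ki kB iB).
Qed.

(** Half of the [4 N m] candidates survive the [N] functions of the block. Their
    distance is bounded from below by going back to the first function of all,
    which is Lipschitz: each block costs a factor [rho]. *)
Lemma split_admissible (C0 : R) j I : 0 < C0 ->
  (forall u v, x0 <= u -> u <= v -> v <= y0 -> F 0%N v - F 0%N u <= C0 * (v - u)) ->
  admissible j I -> exists J : nat -> R * R,
    (forall i, (i < 2 * N * m)%N ->
       [/\ admissible j.+1 (J i), I.1 <= (J i).1 & (J i).2 <= I.2]) /\
    (forall i k, (i < 2 * N * m)%N -> (k < 2 * N * m)%N -> i <> k -> forall x y,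
       (J i).1 <= x <= (J i).2 -> (J k).1 <= y <= (J k).2 ->
       cell_span / (C0 * rho ^+ j.+1) <= `|x - y|).
Proof.
move=> C00 lip adm; have [J JP] := candidates adm.
pose B (d : 'I_N) := [set i : 'I_(4 * N * m) | `[< hits_integer (j * N + d) (J i) >]]%SET.
have Bm d : (#|B d| <= m + 2)%N := bad_candidates_le adm (ltn_ord d) JP.
have M0 : (0 < 2 * N * m)%N by rewrite !muln_gt0 N0 (ltnW m2).
have few_bad : (N * (m + 2) + 2 * N * m <= 4 * N * m)%N.
  have -> : (4 * N * m = 2 * N * m + 2 * N * m)%N by rewrite -!mulnDl.
  by rewrite leq_add2r [(2 * N)%N]mulnC -mulnA leq_pmul2l // mul2n -addnn leq_add2l.
have [e [eB einj]] := enumerate_outside_small_sets M0 Bm few_bad.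
have [xa ab by0 span avoided] := adm.
exists (fun i => J (e i)); split=> [i iM|i k iM kM ik x y xi yk].
  have [a1 i12 b2 h1 h2] := JP _ (ltn_ord (e i)).
  split=> //; split; rewrite ?(le_trans xa) ?(le_trans b2) //.
    by rewrite h1 h2 opprD addrACA subrr add0r -mulrBl -natrB ?subSnn ?mul1r.
  move=> n z nj zi; have /andP[z1 z2] := zi.
  case: (ltnP n (j * N)) => [nlt|nge].
    by apply: avoided => //; rewrite (le_trans a1) //= (le_trans z2).
  have dN : (n - j * N < N)%N by rewrite ltn_subLR // addnC -mulSn.
  move=> l; rewrite leNgt; apply/negP => near_l.
  have /negP := eB i (Ordinal dN) iM; apply; rewrite inE; apply/asboolP.
  by exists z, l; rewrite /= subnKC.
have key p q : (p < q)%N -> (q < 4 * N * m)%N -> forall u v,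
    (J p).1 <= u <= (J p).2 -> (J q).1 <= v <= (J q).2 ->
    cell_span / (C0 * rho ^+ j.+1) <= v - u.
  move=> pq qK u v up vq.
  have [uv spread] := candidates_apart adm JP pq qK up vq.
  have [a1 _ _ _ _] := JP p (ltn_trans pq qK); have [_ _ b2 _ _] := JP q qK.
  have /andP[up1 _] := up; have /andP[_ vq2] := vq.
  have xu : x0 <= u by rewrite (le_trans xa) ?(le_trans a1).
  have vy : v <= y0 by rewrite (le_trans vq2) ?(le_trans b2).
  have iter t : F (t * N)%N v - F (t * N)%N u <= rho ^+ t * (C0 * (v - u)).
    elim: t => [|t IH]; first by rewrite expr0 mul1r mul0n lip.
    rewrite mulSnr (le_trans (grow_le _ (leqnn N) xu uv vy)) //.
    by rewrite exprS -mulrA ler_pM2l.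
  rewrite ler_pdivrMr ?mulr_gt0 ?exprn_gt0 //.
  by rewrite (le_trans spread) // (le_trans (iter _)) // mulrC mulrAC mulrC mulrA.
case: (ltngtP (e i) (e k)) => [lt|lt|/val_inj/(einj i k iM kM)//].
  by rewrite distrC (le_trans (key _ _ lt (ltn_ord _) _ _ xi yk)) // ler_norm.
by rewrite (le_trans (key _ _ lt (ltn_ord _) _ _ yk xi)) // ler_norm.
Qed.

(** Each level has [2 N m] times more cells than the previous one and contracts
    the gaps by [rho] at most; [rho `^ s <= 2 N m] is exactly what makes the
    inverse of the resulting chart Hoelder of exponent [s]. *)
Lemma avoid_integers_chart (C0 s : R) : 0 <= s -> x0 <= y0 -> 0 < C0 ->
  (forall u v, x0 <= u -> u <= v -> v <= y0 -> F 0%N v - F 0%N u <= C0 * (v - u)) ->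
  cell_span <= F 0%N y0 - F 0%N x0 ->
  rho `^ s <= (2 * N * m)%:R ->
  exists (C : R) (g : R -> R), [/\ 0 < C,
    forall u, 0 <= u < 1 -> x0 <= g u <= y0,
    forall u, 0 <= u < 1 -> forall n, avoids_integers n (g u) &
    forall u v, 0 <= u < 1 -> 0 <= v < 1 -> `|u - v| <= C * `|g u - g v| `^ s].
Proof.
move=> s0 xy0 C00 lip span0 rhoM.
set M := (2 * N * m)%N in rhoM.
have M1 : (1 < M)%N.
  rewrite /M -mulnA (@leq_trans (2 * 1)%N) // leq_pmul2l // muln_gt0 N0 /=.
  exact: ltnW.
have M0 : 0 < M%:R :> R by rewrite ltr0n ltnW.
have [] := @cantor_scheme R M M1 admissible
  (fun j => cell_span / (C0 * rho ^+ j.+1)) (x0, y0).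
- by split => //= n z; rewrite mul0n.
- by move=> j I [].
- by move=> j I adm; exact: split_admissible C00 lip adm.
move=> g [gI gdist]; exists (M%:R * (C0 / cell_span) `^ s), g; split.
- by rewrite mulr_gt0 // powR_gt0 // divr_gt0.
- move=> u /gI[I IP]; have [[xI _ Iy _ _] /andP[Ig gI']] := IP 0%N.
  by rewrite (le_trans xI) ?(le_trans gI').
- move=> u /gI[I IP] n; have [[_ _ _ _ +] gu] := IP n.+1; apply=> //.
  by rewrite mulSn -addn1 addnC leq_add // leq_pmulr.
move=> u v u01 v01; have [->|uv] := eqVneq u v.
  by rewrite subrr normr0 mulr_ge0 ?powR_ge0 // mulr_ge0 ?powR_ge0 // ltW.
have [j [close far]] := gdist u v u01 v01 uv.
apply: le_trans close _.
have rj0 : 0 < rho ^+ j.+1 by rewrite exprn_gt0.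
have gap0 : 0 <= cell_span / (C0 * rho ^+ j.+1) by rewrite divr_ge0 // ltW // mulr_gt0.
apply: le_trans (_ : M%:R * (C0 / cell_span) `^ s *
                     (cell_span / (C0 * rho ^+ j.+1)) `^ s <= _); last first.
  rewrite ler_pM2l ?mulr_gt0 ?powR_gt0 ?divr_gt0 //.
  by apply: ge0_ler_powR => //; rewrite nnegrE.
rewrite -mulrA -powRM ?divr_ge0 ?(ltW C00) ?(ltW D0) //; last exact/ltW/mulr_gt0.
have -> : C0 / cell_span * (cell_span / (C0 * rho ^+ j.+1)) = (rho ^+ j.+1)^-1.
  by field; rewrite !gt_eqF.
have -> : (rho ^+ j.+1)^-1 `^ s = ((rho `^ s) ^+ j.+1)^-1 by exact: powR_exprV.
rewrite ler_pdivlMr ?exprn_gt0 ?powR_gt0 // mulrC ler_pdivrMr ?exprn_gt0 //.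
by rewrite -exprS lerXn2r // nnegrE ?powR_ge0 // ltW.
Qed.

End avoid_integers.

(** * Crossings of a spiral as functions of its slope *)

Lemma expR_diff_bounds (R : realType) (x y : R) :
  expR x * (y - x) <= expR y - expR x <= expR y * (y - x).
Proof.
have e0 := expR_gt0 x; have e1 := expR_gt0 y.
have h1 := expR_ge1Dx (y - x); have h2 := expR_ge1Dx (x - y).
apply/andP; split.
  have -> : expR y = expR x * expR (y - x) by rewrite -expRD; congr expR; lra.
  by rewrite -[X in _ <= _ - X]mulr1 -mulrBr ler_pM2l //; lra.
have -> : expR x = expR y * expR (x - y) by rewrite -expRD; congr expR; lra.
by rewrite -[X in X - _ <= _]mulr1 -mulrBr ler_pM2l //; lra.
Qed.

(** Exponential growth beats both the number of functions in a block and the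
    bounded factors lost in the construction. Below, [a] is the slowest rate of
    expansion of the functions and [b] is [s] times the fastest one. *)
Lemma block_parameters (R : realType) (a b : R) : 0 <= b -> b < a ->
  exists N m : nat, [/\ (0 < N)%N, (2 <= m)%N,
    (8 * N * m)%:R <= expR (a * N%:R) & 2 * expR (b * N%:R) <= (2 * N * m)%:R].
Proof.
move=> b0 ba; pose dl := a - b; have dl0 : 0 < dl by rewrite subr_gt0.
pose N := (Num.truncn (48 / dl ^+ 2)).+1.
have Nbig : 48 <= dl ^+ 2 * N%:R.
  rewrite mulrC -ler_pdivrMr ?exprn_gt0 //; exact/ltW/truncnS_gt.
have N1 : 1 <= N%:R :> R by rewrite ler1n.
set M := N%:R in Nbig N1.
have M0 : 0 <= dl * M by rewrite mulr_ge0 ?(ltW dl0) // (le_trans ler01).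
have growth : 16 * M + 8 <= expR (dl * M).
  have := expR_ge1Dxn 1 M0; rewrite (_ : 2`!%:R = 2) // => h.
  have : 48 * M <= (dl * M) ^+ 2.
    by rewrite exprMn expr2 mulrA -expr2 -mulrA mulrA ler_wpM2r // (le_trans ler01).
  by move: h; lra.
have eb1 : 1 <= expR (b * M) by rewrite -expR0 ler_expR mulr_ge0 // (le_trans ler01).
have aE : expR (a * M) = expR (b * M) * expR (dl * M).
  by rewrite -expRD; congr expR; rewrite /dl; lra.
have big : expR (b * M) * (16 * M + 8) <= expR (a * M).
  by rewrite aE ler_pM2l // expR_gt0.
have M8 : 0 < 8 * M by lra.
(* The largest value compatible with the third condition. *)
pose m := Num.truncn (expR (a * M) / (8 * M)).
have q0 : 0 <= expR (a * M) / (8 * M) by rewrite divr_ge0 ?expR_ge0 ?ltW.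
have /andP[m1 m2] := truncn_itv q0.
rewrite -/m ler_pdivlMr // in m1; rewrite -/m ltr_pdivrMr // -natr1 in m2.
exists N, m; split => //.
- rewrite /m truncn_ge_nat // ler_pdivlMr //.
  apply: le_trans big; apply: le_trans (_ : 1 * (16 * M + 8) <= _); first by lra.
  by rewrite ler_pM2r //; lra.
- by rewrite !natrM -/M mulrC.
- rewrite !natrM -/M.
  have : expR (b * M) * (16 * M + 8) = 16 * (expR (b * M) * M) + 8 * expR (b * M) by ring.
  have : M <= expR (b * M) * M by rewrite ler_peMl //; lra.
  by move: m2 big; lra.
Qed.

Section exponential_family.
Context {R : realType}.
Variables (a E0 : R).
Hypothesis E0_gt0 : 0 < E0.



(** The spiral [t |-> exp (a + t al) (cos (b + t), sin (b + t))] meets the vertical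
    axis when [b + t] is an odd multiple of [pi / 2]; when [E0] is one of these
    values of [t], the next ones are [E0 + pi * n], and [crossing n al] is the
    distance to the origin of the corresponding point. It is studied as a
    function of the slope [al]. *)
Definition crossing (n : nat) (al : R) : R := expR (a + al * (E0 + pi * n%:R)).

Let crossingD n d al : crossing (n + d) al = crossing n al * expR (al * (pi * d%:R)).
Proof. by rewrite /crossing -expRD natrD; congr expR; ring. Qed.

Let crossing_diff n u v : u <= v ->
  crossing n u * ((E0 + pi * n%:R) * (v - u)) <= crossing n v - crossing n u.
Proof.
move=> uv.
have /andP[+ _] := expR_diff_bounds (a + u * (E0 + pi * n%:R)) (a + v * (E0 + pi * n%:R)).
by apply: le_trans; rewrite le_eqVlt; apply/orP; left; apply/eqP; rewrite /crossing; ring.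
Qed.

Let pin_ge0 d : 0 <= pi * d%:R :> R. Proof. by rewrite mulr_ge0 // pi_ge0. Qed.

Let E_gt0 n : 0 < E0 + pi * n%:R.
Proof. by have := pin_ge0 n; have := E0_gt0; lra. Qed.

Lemma crossing_mono n u v : u <= v -> crossing n u <= crossing n v.
Proof. by move=> uv; rewrite ler_expR lerD2l ler_wpM2r // ltW. Qed.

Lemma crossing_growth_ge al0 n d u v : al0 <= u -> u <= v ->
  expR (al0 * (pi * d%:R)) * (crossing n v - crossing n u) <=
  crossing (n + d) v - crossing (n + d) u.
Proof.
move=> au uv; rewrite !crossingD.
have h0 := crossing_mono n uv; have hu : 0 < crossing n u by exact: expR_gt0.
have e1 : expR (al0 * (pi * d%:R)) <= expR (u * (pi * d%:R)) by rewrite ler_expR ler_wpM2r.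
have e2 : expR (u * (pi * d%:R)) <= expR (v * (pi * d%:R)) by rewrite ler_expR ler_wpM2r.
apply: (@le_trans _ _ (expR (u * (pi * d%:R)) * (crossing n v - crossing n u))).
  by rewrite ler_wpM2r // subr_ge0.
have : expR (u * (pi * d%:R)) * crossing n v <= expR (v * (pi * d%:R)) * crossing n v.
  by rewrite ler_wpM2r // (le_trans (ltW hu)).
by lra.
Qed.

(** Differentiating [crossing (n + d)] in the parameter multiplies the growth
    factor by [E (n + d) / E n], which stays below 2 as long as [pi * d <= E0]. *)
Lemma crossing_growth_le al1 n d u v : pi * d%:R <= E0 -> u <= v -> v <= al1 ->
  crossing (n + d) v - crossing (n + d) u <=
  2 * expR (al1 * (pi * d%:R)) * (crossing n v - crossing n u).
Proof.
move=> dE uv va; rewrite !crossingD.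
have h0 := crossing_mono n uv; have hu : 0 < crossing n u by exact: expR_gt0.
set p := pi * d%:R; have p0 : 0 <= p := pin_ge0 d.
have pE : p <= E0 + pi * n%:R by rewrite (le_trans dE) // lerDl.
have e1 : expR (v * p) <= expR (al1 * p) by rewrite ler_expR ler_wpM2r.
apply: (@le_trans _ _ (2 * expR (v * p) * (crossing n v - crossing n u))); last first.
  by rewrite ler_wpM2r ?subr_ge0 // ler_pM2l.
have /andP[_ e2] := expR_diff_bounds (u * p) (v * p).
have e3 : crossing n u * (expR (v * p) - expR (u * p)) <=
          expR (v * p) * (crossing n v - crossing n u).
  apply: (@le_trans _ _ (crossing n u * (expR (v * p) * (v * p - u * p)))).
    by rewrite ler_pM2l.
  rewrite mulrCA ler_pM2l ?expR_gt0 //.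
  apply: le_trans (crossing_diff n uv); rewrite ler_pM2l // -mulrBl mulrC.
  by rewrite ler_wpM2r // subr_ge0.
have -> : crossing n v * expR (v * p) - crossing n u * expR (u * p) =
   expR (v * p) * (crossing n v - crossing n u) +
   crossing n u * (expR (v * p) - expR (u * p)) by ring.
by rewrite -mulrA mulr_natl mulr2n lerD2l.
Qed.

Lemma crossing_continuous n : continuous (crossing n).
Proof.
move=> x; apply: continuous_comp; last exact: continuous_expR.
apply: continuousD; first exact: cst_continuous.
exact: mulrr_continuous.
Qed.

Lemma crossing_lipschitz al1 n u v : u <= v -> v <= al1 ->
  crossing n v - crossing n u <=
  crossing n al1 * (E0 + pi * n%:R) * (v - u).
Proof.
move=> uv va.
have /andP[_ h] := expR_diff_bounds (a + u * (E0 + pi * n%:R)) (a + v * (E0 + pi * n%:R)).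
apply: le_trans h _.
have -> : a + v * (E0 + pi * n%:R) - (a + u * (E0 + pi * n%:R)) =
  (E0 + pi * n%:R) * (v - u) by ring.
rewrite -[leRHS]mulrA ler_wpM2r ?mulr_ge0 ?subr_ge0 ?(ltW (E_gt0 n)) //.
exact: crossing_mono.
Qed.

(** As soon as the modulus is at least 1, the variation with the slope is at least
    proportional to the angle: this is how initial cells are found. *)
Lemma crossing_spread n u v : u <= v -> 0 <= a + u * (E0 + pi * n%:R) ->
  (E0 + pi * n%:R) * (v - u) <= crossing n v - crossing n u.
Proof.
move=> uv pos; apply: le_trans (crossing_diff n uv).
rewrite ler_peMl ?mulr_ge0 ?subr_ge0 ?(ltW (E_gt0 n)) //.
by rewrite -expR0 ler_expR.
Qed.

End exponential_family.

Lemma natr_mul_unbounded (R : realType) (x B : R) : 0 < x ->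
  exists n : nat, B <= x * n%:R.
Proof.
move=> x0; exists (Num.truncn (B / x)).+1.
by rewrite mulrC -ler_pdivrMr //; exact/ltW/truncnS_gt.
Qed.

(** The crossings expand from one half-turn to the next by [exp (pi al)], with
    [al0 <= al <= al1]. Over a block of [N] half-turns there are about
    [exp (pi al0 N)] cells for a contraction of about [exp (pi al1 N)], so that
    all exponents [s < al0 / al1] are reached. The shift by 1/2 turns closeness to
    integers into closeness to odd multiples of [pi]. *)
Lemma crossing_avoidance_chart (R : realType) (a c al0 al1 s : R) :
  0 < al0 -> al0 < al1 -> 0 <= s -> s * al1 < al0 ->
  exists (C eta : R) (n0 : nat) (g : R -> R), [/\ 0 < C, 0 < eta,
    forall u, 0 <= u < 1 -> al0 <= g u <= al1,
    forall u, 0 <= u < 1 -> forall n (l : int),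
      eta <= `|crossing a (c + pi * n0%:R) n (g u) / (2 * pi) - 1 / 2 - l%:~R| &
    forall u v, 0 <= u < 1 -> 0 <= v < 1 -> `|u - v| <= C * `|g u - g v| `^ s].
Proof.
move=> al00 al01 s0 sal.
have pi0 : 0 < pi :> R := pi_gt0 R.
have [||N [m [N0 m2 Nm1 Nm2]]] := @block_parameters R (al0 * pi) (s * al1 * pi).
- by rewrite !mulr_ge0 ?(ltW pi0) // ltW // (lt_trans al00).
- by rewrite ltr_pM2r.
pose dal := al1 - al0; have dal0 : 0 < dal by rewrite subr_gt0.
(* Starting late enough makes the modulus at least 1 ([B1]), the first cell wide
   enough ([B2]) and the angles large compared to a block ([B3]). *)
pose B1 : R := `|a| / al0; pose B2 : R := 2 * pi / dal; pose B3 := pi * N%:R : R.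
have B10 : 0 <= B1 by rewrite divr_ge0 // ltW.
have B20 : 0 <= B2 by rewrite divr_ge0 ?mulr_ge0 ?(ltW pi0) // ltW.
have B30 : 0 < B3 by rewrite mulr_gt0 ?ltr0n.
have [n0 n0P] := natr_mul_unbounded (B1 + B2 + B3 - c) pi0.
pose E0 := c + pi * n0%:R.
have E0N : pi * N%:R <= E0 by rewrite -/B3 /E0; lra.
have E0B1 : B1 <= E0 by rewrite /E0; lra.
have E0B2 : B2 <= E0 by rewrite /E0; lra.
have E00 : 0 < E0 := lt_le_trans B30 E0N.
pose i2p := (2 * pi : R)^-1; have i2p0 : 0 < i2p by rewrite invr_gt0 mulr_gt0.
pose F n al := crossing a E0 n al / (2 * pi) - 1 / 2.
have FB n u v : F n v - F n u = i2p * (crossing a E0 n v - crossing a E0 n u).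
  by rewrite /F /i2p; ring.
pose rho := 2 * expR (al1 * pi * N%:R).
have al10 : 0 < al1 by lra.
have eN1 : 1 <= expR (al1 * pi * N%:R).
  by rewrite -expR0 ler_expR !mulr_ge0 ?(ltW pi0) ?(ltW al10).
have rho1 : 1 <= rho by rewrite /rho; lra.
have diff0 n u v : u <= v -> 0 <= crossing a E0 n v - crossing a E0 n u.
  by move=> uv; rewrite subr_ge0; exact: crossing_mono.
have cont n : continuous (F n).
  move=> x; apply: cvgB; last exact: cvg_cst.
  by apply: cvgM; [exact: crossing_continuous|exact: cvg_cst].
have mono n u v : al0 <= u -> u <= v -> v <= al1 -> F n u <= F n v.
  by move=> _ uv _; rewrite -subr_ge0 FB mulr_ge0 ?(ltW i2p0) // diff0.
have ge1 n d u v : (d <= N)%N -> al0 <= u -> u <= v -> v <= al1 ->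
    F n v - F n u <= F (n + d)%N v - F (n + d)%N u.
  move=> _ au uv _; rewrite !FB ler_pM2l //.
  apply: le_trans (crossing_growth_ge a E00 n d au uv).
  by rewrite ler_peMl ?diff0 // -expR0 ler_expR !mulr_ge0 ?(ltW pi0) // ltW.
have block n u v : al0 <= u -> u <= v -> v <= al1 ->
    (8 * N * m)%:R * (F n v - F n u) <= F (n + N)%N v - F (n + N)%N u.
  move=> au uv _; rewrite !FB mulrCA ler_pM2l //.
  apply: le_trans (crossing_growth_ge a E00 n N au uv).
  by rewrite ler_wpM2r ?diff0 // mulrA.
have le n d u v : (d <= N)%N -> al0 <= u -> u <= v -> v <= al1 ->
    F (n + d)%N v - F (n + d)%N u <= rho * (F n v - F n u).
  move=> dN _ uv va; have dE : pi * d%:R <= E0.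
    by apply: le_trans E0N; rewrite ler_pM2l // ler_nat.
  rewrite !FB mulrCA ler_pM2l //.
  apply: le_trans (crossing_growth_le a E00 n dE uv va) _.
  rewrite ler_wpM2r ?diff0 // ler_pM2l // ler_expR mulrA.
  by rewrite ler_wpM2l ?mulr_ge0 ?(ltW pi0) ?(ltW al10) // ler_nat.
have [] := @avoid_integers_chart R F al0 al1 N m rho N0 m2 rho1 cont mono ge1 block le
  (i2p * (crossing a E0 0 al1 * (E0 + pi * 0%:R))) s s0 (ltW al01).
- by rewrite !mulr_gt0 ?expR_gt0 // mulr0 addr0.
- move=> u v _ uv va; rewrite FB -!mulrA ler_pM2l // mulrA.
  exact: crossing_lipschitz.
- rewrite FB.
  have pos : 0 <= a + al0 * (E0 + pi * 0%:R).
    rewrite mulr0 addr0; have : `|a| <= al0 * E0 by rewrite mulrC -ler_pdivrMr.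
    by rewrite ler_norml; lra.
  apply: le_trans (_ : i2p * ((E0 + pi * 0%:R) * (al1 - al0)) <= _); last first.
    rewrite ler_pM2l //; by apply: crossing_spread => //; exact: ltW.
  rewrite mulr0 addr0; apply: le_trans (_ : 1 <= _).
    by rewrite /cell_span invf_le1 ?ltr0n ?muln_gt0 // ler1n muln_gt0.
  rewrite /i2p mulrC ler_pdivlMr ?mulr_gt0 // mul1r -/dal.
  by rewrite -ler_pdivrMr.
- rewrite /rho powRM ?expR_ge0 //.
  apply: le_trans Nm2; apply: ler_pM; rewrite ?powR_ge0 //.
    apply: ler1_powR; first by rewrite ler1n.
    by rewrite -(ler_pM2r al10) mul1r ltW // (lt_trans sal).
  by rewrite -expRM; rewrite le_eqVlt; apply/orP; left; apply/eqP; congr expR; ring.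
move=> C [g [C0 gI gav gdist]].
exists C, (avoid_radius N rho), n0, g; split => //.
rewrite /avoid_radius /cell_span divr_gt0 ?invr_gt0 ?ltr0n ?muln_gt0 ?mulr_gt0 //.
exact: expR_gt0.
Qed.

(** * Trigonometric estimates *)

Lemma half_turn_sign (R : realType) (k : int) : exists sg : R, [/\ sg * sg = 1,
  forall x, cos (x + k%:~R * pi) = sg * cos x &
  forall x, sin (x + k%:~R * pi) = sg * sin x].
Proof.
have shift (n : nat) : exists sg : R, [/\ sg * sg = 1,
    forall x, cos (x + n%:R * pi) = sg * cos x &
    forall x, sin (x + n%:R * pi) = sg * sin x].
  elim: n => [|n [sg [sg2 c s]]].
    by exists 1; split => [|x|x]; rewrite ?mulr1 // mul0r addr0 mul1r.
  exists (- sg); split => [|x|x]; first by rewrite mulrNN.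
    by rewrite -natr1 mulrDl mul1r addrA cosDpi c mulNr.
  by rewrite -natr1 mulrDl mul1r addrA sinDpi s mulNr.
case: (intP k) => [|n|n]; [exact: (shift 0%N)|exact: (shift n.+1)|].
have [sg [sg2 c s]] := shift n.+1.
have back (x : R) : x = x + (- n.+1%:Z)%:~R * pi + n.+1%:R * pi.
  by rewrite rmorphN /= mulNr -addrA addNr addr0.
by exists sg; split => // x; rewrite [in RHS](back x) ?c ?s mulrA sg2 mul1r.
Qed.

Lemma half_turn_rem (R : realType) (x : R) :
  0 <= x - (Num.floor (x / pi))%:~R * pi < pi.
Proof.
have pi0 := pi_gt0 R; have /andP[] := floor_itv (x / pi).
rewrite ler_pdivlMr // ltr_pdivrMr // rmorphD /= mulrDl mul1r => lo hi.
by rewrite subr_ge0 lo ltrBlDl.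
Qed.

Lemma cos_far_from_odd_multiples (R : realType) (y eta : R) : 0 < eta -> eta <= 1 / 2 ->
  (forall l : int, eta <= `|y / (2 * pi) - 1 / 2 - l%:~R|) ->
  - cos (2 * pi * eta) <= cos y.
Proof.
move=> eta0 eta2 far; have pi0 := pi_gt0 R.
pose l := Num.floor (y / (2 * pi)); have /andP[] := floor_itv (y / (2 * pi)).
have [L LE] : exists L : R, L = l%:~R by exists l%:~R.
rewrite -/l rmorphD /= mulr1z -LE => lo hi; have {}far := far l; rewrite -LE in far.
pose z := y - pi - 2 * pi * L.
have zE : z = 2 * pi * (y / (2 * pi) - 1 / 2 - L).
  rewrite /z; have : (pi : R) != 0 by rewrite gt_eqF.
  by move: (pi : R) => p p0; field.
have znorm : `|z| = 2 * pi * `|y / (2 * pi) - 1 / 2 - L|.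
  by rewrite zE normrM ger0_norm // mulr_ge0 ?(ltW pi0).
have z1 : 2 * pi * eta <= `|z|.
  by rewrite znorm ler_pM2l ?mulr_gt0.
have z2 : `|z| <= pi.
  rewrite znorm; have : `|y / (2 * pi) - 1 / 2 - L| <= 1 / 2 by rewrite ler_norml; lra.
  by rewrite -(@ler_pM2l _ (2 * pi)) ?mulr_gt0 //; lra.
have cosz : cos z <= cos (2 * pi * eta).
  have -> : cos z = cos `|z| by case: (ger0P z); rewrite ?cosN.
  rewrite leNgt; apply/negP; rewrite ltr_cos ?in_itv /= ?normr_ge0 //.
    by rewrite ltNge z1.
  by rewrite mulr_ge0 ?(ltW eta0) ?mulr_ge0 ?(ltW pi0) //= (le_trans z1).
have [sg [sg2 c _]] := half_turn_sign R l; rewrite -LE in c.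
have -> : cos y = - cos z.
  have -> : y = z + L * pi + L * pi + pi by rewrite /z; ring.
  by rewrite cosDpi !c mulrA sg2 mul1r.
by rewrite lerN2.
Qed.

Lemma cos_lipschitz (R : realType) (x y : R) : `|cos x - cos y| <= `|x - y|.
Proof.
wlog xy : x y / x <= y.
  move=> H; case/orP: (le_total x y) => [|yx]; first exact: H.
  by rewrite distrC [leRHS]distrC; exact: H.
have [z _ e] := @MVT_segment R cos (fun x => - sin x) x y xy
  (fun z _ => is_derive_cos z) (continuous_subspaceT (@continuous_cos R)).
rewrite distrC e normrM normrN [leRHS]distrC.
by rewrite ler_piMl ?normr_ge0 // sin_max.
Qed.

(** Bounding the sine by 1/2 keeps the cosine above 1/2 on the whole segment from 0
    to the angle, where the mean value theorem applies. *)
Lemma angle_le_sin (R : realType) (z : R) : `|z| <= pi / 2 -> `|sin z| <= 1 / 2 ->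
  `|z| <= 2 * `|sin z|.
Proof.
wlog z0 : z / 0 <= z.
  move=> H; case/orP: (le_total 0 z) => [|zle]; first exact: H.
  by rewrite -(normrN z) -(normrN (sin z)) -sinN; apply: H; rewrite oppr_ge0.
have sinz0 : `|z| <= pi / 2 -> 0 <= sin z.
  move=> zpi; apply: sin_ge0_pi; rewrite z0; have := pi_gt0 R.
  by move: zpi; rewrite ger0_norm //; lra.
move=> zpi; have sz0 := sinz0 zpi; rewrite !ger0_norm // in zpi * => sz.
have cz0 : 0 <= cos z by apply: cos_ge0_pihalf; have := pi_gt0 R; lra.
have cz : 1 / 2 <= cos z by have := cos2Dsin2 z; nra.
have [xi] := @MVT_segment R sin cos 0 z z0
  (fun z _ => is_derive_sin z) (continuous_subspaceT (@continuous_sin R)).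
rewrite in_itv /= => /andP[xi0 xiz]; rewrite sin0 !subr0 => ->.
have : cos z <= cos xi.
  by rewrite leNgt; apply/negP; rewrite ltr_cos ?in_itv /=; have := pi_gt0 R; lra.
by nra.
Qed.

Lemma expR_sub1_le (R : realType) (x : R) : `|x| <= 1 / 2 -> `|expR x - 1| <= 2 * `|x|.
Proof.
move=> x2; have := expR_ge1Dx x; have /andP[_] := expR_diff_bounds 0 x.
rewrite expR0 subr0; have := expR_gt0 x.
by case: (ger0P x) x2 => x0 x2 e0 e1 e2; rewrite ler_norml; nra.
Qed.

(** * The image of a line under the double exponential *)

Lemma near_unit_circle (R : realType) (X Y c s e : R) :
  c ^+ 2 + s ^+ 2 = 1 -> 0 < e -> e <= 1 / 12 ->
  `|expR X * cos Y - c| < e -> `|expR X * sin Y - s| < e ->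
  `|X| <= 12 * e /\ `|cos Y - c| <= 7 * e.
Proof.
move=> cs e0 e12 hc hs.
have X1 := expR_ge1Dx X; have X2 := expR_ge1Dx (- X); have E0 := expR_gt0 X.
have EV : expR (- X) * expR X = 1 by rewrite -expRD addNr expR0.
have sq : expR X ^+ 2 = (expR X * cos Y) ^+ 2 + (expR X * sin Y) ^+ 2.
  by rewrite !exprMn -mulrDr cos2Dsin2 mulr1.
have c1 : `|c| <= 1 by rewrite ler_norml; nra.
have s1 : `|s| <= 1 by rewrite ler_norml; nra.
have cY := cos_max Y.
move: sq X1 X2 E0 EV hc hs; set E := expR X; set P := E * cos Y; set Q := E * sin Y.
move=> sq X1 X2 E0 EV hc hs.
pose p := P - c; pose q := Q - s.
have sqE : E ^+ 2 - 1 = 2 * (c * p) + 2 * (s * q) + p ^+ 2 + q ^+ 2.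
  by rewrite /p /q; lra.
have cp : `|c * p| <= e.
  by rewrite normrM -[leRHS]mul1r ler_pM // ltW.
have sq' : `|s * q| <= e.
  by rewrite normrM -[leRHS]mul1r ler_pM // ltW.
have small r : `|r| < e -> r ^+ 2 <= e.
  move=> re; rewrite -real_normK ?num_real // expr2 -[leRHS]mulr1 ler_pM // ltW //.
  by rewrite (lt_trans re); lra.
have E2 : `|E ^+ 2 - 1| <= 6 * e.
  have := small _ hc; have := small _ hs; rewrite -/p -/q sqE.
  have := sqr_ge0 p; have := sqr_ge0 q.
  by move: cp sq'; rewrite !ler_norml; lra.
have E1 : `|E - 1| <= 6 * e.
  move: E2; rewrite !ler_norml => /andP[l u].
  by apply/andP; split; nra.
have [l u] : -(6 * e) <= E - 1 /\ E - 1 <= 6 * e by move: E1; rewrite ler_norml => /andP[].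
split.
  rewrite ler_norml; apply/andP; split; last lra.
  have : expR (- X) <= 1 + 12 * e.
    by rewrite -(ler_pM2r E0) EV; nra.
  by lra.
have -> : cos Y - c = (1 - E) * cos Y + p by rewrite /p /P; ring.
apply: le_trans (ler_normD _ _) _.
have : `|(1 - E) * cos Y| <= 6 * e.
  rewrite normrM -[leRHS]mulr1; apply: ler_pM => //; by rewrite distrC.
by move: hc; rewrite -/p; lra.
Qed.

(** A point of the spiral within [12 e] of the vertical axis makes with this axis
    an angle [z] whose sine is at most [12 e] over the modulus. Turning by [z]
    towards the axis multiplies the modulus by [exp (- al z)], hence changes the
    ordinate by an amount of the order of modulus times angle, that is of [e],
    however large the modulus is. *)
Lemma spiral_near_crossing (R : realType) (a b al t e : R) (n0 : nat) :
  0 < al -> 0 < e -> 24 * e <= 1 -> 48 * al * e <= 1 ->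
  0 <= a + t * al -> n0%:R * pi <= b + t ->
  `|expR (a + t * al) * cos (b + t)| <= 12 * e ->
  exists n, `|cos (expR (a + t * al) * sin (b + t)) -
              cos (crossing a (pi / 2 - b + pi * n0%:R) n al)| <= 12 * (1 + 4 * al) * e.
Proof.
move=> al0 e0 e24 e48 big late hX; have pi0 := pi_gt0 R.
pose k := Num.floor ((b + t) / pi).
have n0k : (Posz n0 <= k)%R by rewrite /k floor_ge_int ler_pdivlMr.
have [kn kE] : exists kn : nat, k = kn by case: k n0k => // kn _; exists kn.
rewrite kE lez_nat in n0k.
have := half_turn_rem (b + t); rewrite -/k kE.
pose z := b + t - kn%:R * pi - pi / 2 => zpi.
have z2 : `|z| <= pi / 2.
  by rewrite /z ler_norml; move: zpi => /andP[]; rewrite -[kn%:~R]/(kn%:R); lra.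
have [sg [sg2 hcos hsin]] := half_turn_sign R kn.
have sgn : `|sg| = 1.
  by apply/eqP; rewrite -(@eqrXn2 _ 2) // expr1n real_normK ?num_real // expr2 sg2.
have bt : b + t = z + pi / 2 + kn%:~R * pi by rewrite /z -[kn%:~R]/(kn%:R); ring.
have cosbt : `|cos (b + t)| = `|sin z|.
  by rewrite bt hcos cosDpihalf normrM sgn mul1r normrN.
have sinbt : sin (b + t) = sg * cos z by rewrite bt hsin sinDpihalf.
set L := expR (a + t * al) in hX *.
have L1 : 1 <= L by rewrite -expR0 ler_expR.
have L0 : 0 < L by lra.
have Lsin : L * `|sin z| <= 12 * e.
  by rewrite -cosbt -[X in X * _]gtr0_norm // -normrM.
have sin_e : `|sin z| <= 12 * e by apply: le_trans Lsin; rewrite ler_peMl.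
have zsin : `|z| <= 2 * `|sin z| by apply: angle_le_sin => //; lra.
have sz0 := normr_ge0 (sin z).
have zal : `|- (al * z)| <= 2 * al * `|sin z|.
  by rewrite normrN normrM gtr0_norm // [2 * al]mulrC -mulrA ler_pM2l.
have ez : `|expR (- (al * z)) - 1| <= 4 * al * `|sin z|.
  apply: le_trans (expR_sub1_le _) _.
    by apply: le_trans zal _; nra.
  by lra.
have cz : `|1 - cos z| <= `|sin z|.
  have cz0 : 0 <= cos z by apply: cos_ge0_pihalf; rewrite -ler_norml.
  have cz1 := cos_le1 z; have s1 := sin_max z; have := cos2Dsin2 z.
  rewrite -[sin z ^+ 2]real_normK ?num_real // => h.
  by rewrite ger0_norm ?subr_ge0 //; nra.
exists (kn - n0)%N.
have -> : crossing a (pi / 2 - b + pi * n0%:R) (kn - n0) al = L * expR (- (al * z)).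
  rewrite /crossing /L -expRD; congr expR; rewrite natrB // /z; ring.
have -> : cos (L * sin (b + t)) = cos (L * cos z).
  rewrite sinbt; have : sg = 1 \/ sg = -1.
    by have := eqr_norm2; case: (ger0P sg) sgn => _ h; [left|right]; lra.
  by case=> ->; rewrite ?mul1r // mulN1r mulrN cosN.
apply: le_trans (cos_lipschitz _ _) _.
have -> : L * cos z - L * expR (- (al * z)) =
  - (L * ((expR (- (al * z)) - 1) + (1 - cos z))) by ring.
rewrite normrN normrM gtr0_norm //.
apply: (@le_trans _ _ (L * ((4 * al + 1) * `|sin z|))).
  rewrite ler_pM2l // (le_trans (ler_normD _ _)) //.
  by rewrite mulrDl mul1r lerD.
by rewrite mulrCA -mulrA [leRHS]mulrC -mulrA [(1 + _)]addrC; nra.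
Qed.

Section double_exponential_image.
Context {R : realType}.
Implicit Types a b al t c s e : R.

(** With [p = a + i b], the point of [line al p] of parameter [t] has for image by
    the exponential the point [dexp_log + i dexp_arg] of a logarithmic spiral; the
    double exponential has modulus [exp dexp_log] and argument [dexp_arg]. *)
Definition dexp_log a b al t := expR (a + t * al) * cos (b + t).
Definition dexp_arg a b al t := expR (a + t * al) * sin (b + t).

Definition dexp_re a b al t := expR (dexp_log a b al t) * cos (dexp_arg a b al t).
Definition dexp_im a b al t := expR (dexp_log a b al t) * sin (dexp_arg a b al t).

Definition isolated a b al c s := exists2 e, 0 < e &
  forall t, ~ (`|dexp_re a b al t - c| < e /\ `|dexp_im a b al t - s| < e).

Let continuous_line (x y : R) : continuous (fun t : R => x + t * y).
Proof.
by move=> t; apply: cvgD; [exact: cvg_cst|apply: cvgM; [exact: cvg_id|exact: cvg_cst]].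
Qed.

Let continuous_shift (x : R) : continuous (fun t : R => x + t).
Proof. by move=> t; apply: cvgD; [exact: cvg_cst|exact: cvg_id]. Qed.

Let continuous_exp_line (x y : R) : continuous (fun t : R => expR (x + t * y)).
Proof.
by move=> t; apply: continuous_comp; [exact: continuous_line|exact: continuous_expR].
Qed.

Lemma continuous_dexp_log a b al : continuous (dexp_log a b al).
Proof.
move=> t; apply: cvgM; first exact: continuous_exp_line.
by apply: continuous_comp; [exact: continuous_shift|exact: continuous_cos].
Qed.

Lemma continuous_dexp_arg a b al : continuous (dexp_arg a b al).
Proof.
move=> t; apply: cvgM; first exact: continuous_exp_line.
by apply: continuous_comp; [exact: continuous_shift|exact: continuous_sin].
Qed.

Lemma continuous_dexp_re a b al : continuous (dexp_re a b al).
Proof.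
move=> t; apply: cvgM; apply: continuous_comp.
- exact: continuous_dexp_log.
- exact: continuous_expR.
- exact: continuous_dexp_arg.
- exact: continuous_cos.
Qed.

Lemma continuous_dexp_im a b al : continuous (dexp_im a b al).
Proof.
move=> t; apply: cvgM; apply: continuous_comp.
- exact: continuous_dexp_log.
- exact: continuous_expR.
- exact: continuous_dexp_arg.
- exact: continuous_sin.
Qed.

(** Conjugating the line exchanges the slopes [al] and [- al] once the parameter is
    reversed, so that positive slopes suffice. *)
Lemma isolatedN a b al c s : isolated a (- b) (- al) c (- s) -> isolated a b al c s.
Proof.
move=> [e e0 H]; exists e => // t [hc hs]; apply: (H (- t)).
have eL : dexp_log a (- b) (- al) (- t) = dexp_log a b al t.
  by rewrite /dexp_log mulrNN -opprD cosN.
have eA : dexp_arg a (- b) (- al) (- t) = - dexp_arg a b al t.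
  by rewrite /dexp_arg mulrNN -opprD sinN mulrN.
rewrite /dexp_re /dexp_im eL eA cosN sinN mulrN; split => //.
by rewrite -opprD normrN.
Qed.

(** The squared distance to [(c, s)] attains its minimum on a compact range of
    parameters. *)
Lemma compact_piece_hits a b al c s T0 T1 : T0 <= T1 ->
  (forall e, 0 < e -> exists t, [/\ T0 <= t, t <= T1,
     `|dexp_re a b al t - c| < e & `|dexp_im a b al t - s| < e]) ->
  exists t, dexp_re a b al t = c /\ dexp_im a b al t = s.
Proof.
move=> T01 dense.
pose phi t := (dexp_re a b al t - c) ^+ 2 + (dexp_im a b al t - s) ^+ 2.
have phic : continuous phi.
  move=> t; apply: cvgD; rewrite /=; under eq_fun do rewrite expr2; rewrite expr2;
    apply: cvgM; apply: cvgB;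
    (exact: continuous_dexp_re || exact: continuous_dexp_im || exact: cvg_cst).
have [t0 _ tmin] := EVT_min T01 (continuous_subspaceT phic).
have phi0 t : 0 <= phi t by rewrite addr_ge0 ?sqr_ge0.
exists t0; have [z|nz] := eqVneq (phi t0) 0.
  move/eqP: z; rewrite paddr_eq0 ?sqr_ge0 // !sqrf_eq0 !subr_eq0.
  by move=> /andP[/eqP -> /eqP ->].
have p0 : 0 < phi t0 by rewrite lt_neqAle eq_sym nz phi0.
pose e := Num.min 1 (phi t0 / 2).
have e0 : 0 < e by rewrite lt_min ltr01 divr_gt0.
have e1 : e <= 1 by rewrite ge_min lexx.
have e2 : e <= phi t0 / 2 by rewrite ge_min lexx orbT.
have [t [l u hc hs]] := dense e e0.
have min_t : phi t0 <= phi t by apply: tmin; rewrite in_itv /= l.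
have small r : `|r| < e -> r ^+ 2 < e.
  move=> re; rewrite -real_normK ?num_real // expr2 -[ltRHS]mulr1.
  by rewrite ltr_pM // (lt_le_trans re).
have lt_t : phi t < 2 * e by rewrite /phi; have := small _ hc; have := small _ hs; lra.
exfalso; lra.
Qed.

(** The candidates are the points [(c, s)] of the unit circle with [c] close to -1.
    Late in the parameter, the curve comes close to the unit circle only near
    crossings, where by hypothesis its real part is bounded away from -1; early,
    it stays in the right half-plane. If no candidate were isolated, each of them
    would therefore be a point of the compact piece in between. But the curve
    lies on the unit circle only at crossings, and these are countably many. *)
Lemma isolated_point_exists a b al eta n0 : 0 < al -> 0 < eta ->
  (forall n (l : int),
    eta <= `|crossing a (pi / 2 - b + pi * n0%:R) n al / (2 * pi) - 1 / 2 - l%:~R|) ->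
  exists c s, isolated a b al c s.
Proof.
move=> al0 eta0 far; have pi0 := pi_gt0 R.
pose eta' : R := Num.min eta (1 / 2).
have eta'0 : 0 < eta' by rewrite lt_min eta0 divr_gt0.
have eta'1 : eta' <= eta by rewrite ge_min lexx.
have eta'2 : eta' <= 1 / 2 by rewrite ge_min lexx orbT.
pose kap : R := 1 - cos (2 * pi * eta').
have kap2 : kap <= 2 by have := cos_geN1 (2 * pi * eta'); rewrite /kap; lra.
have kap0 : 0 < kap.
  rewrite /kap subr_gt0 -[ltRHS](cos0 R) ltr_cos ?in_itv /= ?lexx ?pi_ge0 //.
    by rewrite !mulr_gt0.
  by rewrite !mulr_ge0 ?(ltW pi0) ?(ltW eta'0) //=; nra.
have cosf n : -1 + kap <= cos (crossing a (pi / 2 - b + pi * n0%:R) n al).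
  have -> : -1 + kap = - cos (2 * pi * eta') by rewrite /kap; lra.
  by apply: cos_far_from_odd_multiples => // l; exact: le_trans (far n l).
apply: contrapT => none.
(* Small against the constants 7 and [12 * (1 + 4 al)] lost near the circle and
   near a crossing. *)
pose e0 := kap / (200 * (1 + al)).
have al1 : 0 < 200 * (1 + al) by lra.
have e00 : 0 < e0 by rewrite divr_gt0.
have e0E : e0 * (200 * (1 + al)) = kap by rewrite /e0 divfK // gt_eqF.
have e0al : 0 < e0 * al by rewrite mulr_gt0.
(* The spiral is in the unit disc before [T0] and its half-turns have index at
   least [n0] after [T1]. *)
pose T0 := - a / al.
pose T1 := Num.max T0 (n0%:R * pi - b).
have T01 : T0 <= T1 by rewrite le_max lexx.
have T1n : n0%:R * pi - b <= T1 by rewrite le_max lexx orbT.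
have T0E : T0 * al = - a by rewrite /T0 divfK // gt_eqF.
have hit c : -1 < c -> c < -1 + kap / 4 -> exists t,
    dexp_re a b al t = c /\ dexp_im a b al t = Num.sqrt (1 - c ^+ 2).
  move=> c1 c2; set s := Num.sqrt _.
  have cs : c ^+ 2 + s ^+ 2 = 1 by rewrite sqr_sqrtr; nra.
  have dense e : 0 < e -> exists t, `|dexp_re a b al t - c| < e /\ `|dexp_im a b al t - s| < e.
    move=> e_gt0; apply: contrapT => /forallNP H; apply: none.
    by exists c, s, e.
  apply: (@compact_piece_hits _ _ _ _ _ _ _ T01) => e e_gt0.
  have [|t [hc hs]] := dense (Num.min e e0); first by rewrite lt_min e_gt0.
  move: hc hs; rewrite !lt_min => /andP[hc hc0] /andP[hs hs0].
  exists t; split => //.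
    rewrite leNgt; apply/negP => tT0.
    have small : a + t * al <= 0.
      by have : t * al <= T0 * al; [rewrite ler_pM2r // ltW|lra].
    have L1 : expR (a + t * al) <= 1 by rewrite -expR0 ler_expR.
    have Y1 : `|dexp_arg a b al t| <= 1.
      rewrite /dexp_arg normrM gtr0_norm ?expR_gt0 // -[leRHS]mul1r.
      by rewrite ler_pM ?expR_ge0 // sin_max.
    have cY : 0 <= cos (dexp_arg a b al t).
      apply: cos_ge0_pihalf; rewrite -ler_norml (le_trans Y1) //.
      exact: pihalf_ge1.
    have re0 : 0 <= dexp_re a b al t by rewrite mulr_ge0 ?expR_ge0.
    by move: hc0; rewrite ltr_norml; lra.
  rewrite leNgt; apply/negP => tT1.
  have [|hX hY] := near_unit_circle cs e00 _ hc0 hs0; first by lra.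
  have big : 0 <= a + t * al.
    have : T0 * al <= t * al; last lra.
    by rewrite ler_pM2r // (le_trans T01) // ltW.
  have late : n0%:R * pi <= b + t by lra.
  have [||n near] := @spiral_near_crossing R a b al t e0 n0 al0 e00 _ _ big late hX.
  - by lra.
  - by lra.
  have := cosf n; move: near hY; rewrite /dexp_arg !ler_norml; lra.
pose h (k : int) := cos (dexp_arg a b al (pi / 2 + k%:~R * pi - b)).
have sub : `]-1, -1 + kap / 4[ `<=` range h.
  move=> c; rewrite /= in_itv /= => /andP[c1 c2].
  have [t [tc ts]] := hit c c1 c2.
  have X0 : expR (dexp_log a b al t) = 1.
    have : expR (dexp_log a b al t) ^+ 2 = 1.
      rewrite -[LHS]mulr1 -[X in _ * X = _](cos2Dsin2 (dexp_arg a b al t)) mulrDr -!exprMn.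
      rewrite -/(dexp_re a b al t) -/(dexp_im a b al t) tc ts sqr_sqrtr; first by lra.
      by nra.
    move/eqP; rewrite sqrf_eq1 => /orP[/eqP //|/eqP h1].
    by have := expR_gt0 (dexp_log a b al t); lra.
  have cos0 : cos (b + t) = 0.
    have : dexp_log a b al t = 0 by apply: expR_inj; rewrite X0 expR0.
    by rewrite /dexp_log => /eqP; rewrite mulf_eq0 gt_eqF ?expR_gt0 //= => /eqP.
  pose k := Num.floor ((b + t) / pi).
  have := half_turn_rem (b + t); rewrite -/k => zpi.
  have [sg [sg2 hcos _]] := half_turn_sign R k.
  have rem : b + t - k%:~R * pi = pi / 2.
    have czero : cos (b + t - k%:~R * pi) = cos (pi / 2).
      rewrite cos_pihalf; have := hcos (b + t - k%:~R * pi).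
      rewrite subrK cos0 => /esym/eqP; rewrite mulf_eq0 => /orP[/eqP sg0|/eqP //].
      by move: sg2; rewrite sg0 mul0r => /eqP; rewrite eq_sym oner_eq0.
    apply: cos_inj czero; rewrite in_itv /=; first by case/andP: zpi => -> /ltW.
    by apply/andP; split; lra.
  exists k => //; rewrite /h -tc /dexp_re X0 mul1r; congr (cos (dexp_arg _ _ _ _)).
  by lra.
have cnt : countable (`]-1, -1 + kap / 4[ : set R).
  apply: sub_countable (subset_card_le sub) _.
  by apply: sub_countable (card_image_le _ _) _; exact: countableP.
have := countable_lebesgue_measure0 cnt; rewrite lebesgue_measure_itv /=.
rewrite lte_fin ltrDl divr_gt0 // -EFinB => -[]; lra.
Qed.

End double_exponential_image.

(** * Slopes with a non-dense image *)

Lemma normc_ge_Im (R : rcfType) (x : R[i]) : (`|complex.Im x|%:C)%C <= `|x|.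
Proof.
rewrite normc_def lecR -sqrtr_sqr ler_sqrt ?addr_ge0 ?sqr_ge0 //.
by rewrite lerDr sqr_ge0.
Qed.

Lemma cexp_cexp_line (R : realType) (p : R[i]) (al t : R) :
  cexp (cexp (p + t%:C%C * ('i%C + al%:C%C))) =
  (dexp_re (complex.Re p) (complex.Im p) al t +i*
   dexp_im (complex.Re p) (complex.Im p) al t)%C.
Proof.
have -> : p + t%:C%C * ('i%C + al%:C%C) =
    ((complex.Re p + t * al) +i* (complex.Im p + t))%C.
  case: p => a b /=; simpc; congr (_ +i* _)%C; ring.
by [].
Qed.

Lemma isolated_closure_neqT (R : realType) (p : R[i]) (al c s : R) :
  isolated (complex.Re p) (complex.Im p) al c s ->
  closure ((cexp \o cexp) @` line al p : set (R[i])^o) <> setT.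
Proof.
move=> [e e0 far] cl.
have e0C : 0 < (e%:C)%C by rewrite ltcR.
have : closure ((cexp \o cexp) @` line al p : set (R[i])^o) (c +i* s)%C by rewrite cl.
move=> /(_ _ (nbhsx_ballx (c +i* s : (R[i])^o)%C _ e0C)) [_ [[_ [t _ <-] <-]]].
rewrite /= cexp_cexp_line -ball_normE /ball_ /= => dist.
apply: (far t); split; rewrite -ltcR; apply: le_lt_trans dist; rewrite distrC.
  by apply: le_trans (normc_ge_Re _).
by apply: le_trans (normc_ge_Im _).
Qed.

Lemma isolated_chart (R : realType) (a b al0 al1 s : R) :
  0 < al0 -> al0 < al1 -> 0 <= s -> s * al1 < al0 ->
  exists (C : R) (g : R -> R), [/\ 0 < C,
    forall u, 0 <= u < 1 -> al0 <= g u <= al1,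
    forall u, 0 <= u < 1 -> exists c d, isolated a b (g u) c d &
    forall u v, 0 <= u < 1 -> 0 <= v < 1 -> `|u - v| <= C * `|g u - g v| `^ s].
Proof.
move=> al00 al01 s0 sal.
have [C [eta [n0 [g [C0 eta0 gI far chart]]]]] :=
  crossing_avoidance_chart a (pi / 2 - b) al00 al01 s0 sal.
exists C, g; split => // u u01; have /andP[g0 _] := gI u u01.
exact: isolated_point_exists (lt_le_trans al00 g0) eta0 (far u u01).
Qed.

Lemma open_near_nonzero (R : realType) (X : set R) : open X -> X !=set0 ->
  exists x r : R, [/\ x != 0, 0 < r & forall y, `|x - y| < r -> X y].
Proof.
move=> oX [x Xx]; have /nbhs_ballP[r /= r0 rX] := open_nbhs_nbhs (conj oX Xx).
have inX y : `|x - y| < r -> X y by move=> h; apply: rX; rewrite -ball_normE.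
have [x0|x0] := eqVneq x 0; last by exists x, r.
exists (r / 2), (r / 2); split; rewrite ?gt_eqF ?divr_gt0 // => y.
rewrite ltr_norml => /andP[h1 h2]; apply: inX.
by rewrite x0 sub0r normrN ltr_norml; lra.
Qed.

Theorem theorem5 (R : realType) (p : R[i]) (X : set R) :
  open X -> X !=set0 ->
  hausdorff_dim
    [set alpha | X alpha /\
       closure ((cexp \o cexp) @` line alpha p : set (R[i])^o) <> setT] = 1%E.
Proof.
move=> oX X0; set A := [set alpha | _].
apply/eqP; rewrite eq_le; apply/andP; split.
  apply/lee_addgt0Pr => e e0; apply: ge_ereal_inf; exists (1 + e)%:E => //.
  exists (1 + e) => //; split; first by rewrite addr_ge0 // ltW.
  by apply: hausdorff_measure_line_eq0; rewrite ltrDl.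
apply: le_ereal_inf_tmp => _ [s [s0 As0] <-]; rewrite lee_fin leNgt.
apply/negP => s1.
have [x [r [x0 r0 rX]]] := open_near_nonzero oX X0.
pose al0 := `|x|; have al00 : 0 < al0 by rewrite normr_gt0.
(* Slopes in [[al0, al0 + d]] stay in [X] and have [s < al0 / (al0 + d)]. *)
pose d := Num.min (r / 2) (al0 * (1 - s) / 2).
have d0 : 0 < d by rewrite lt_min !divr_gt0 // mulr_gt0 // subr_gt0.
have dr : d <= r / 2 by rewrite ge_min lexx.
have ds : d <= al0 * (1 - s) / 2 by rewrite ge_min lexx orbT.
have al01 : al0 < al0 + d by rewrite ltrDl.
have sal : s * (al0 + d) < al0.
  have : s * d <= 1 * d by rewrite ler_pM2r // ltW.
  have : 0 < al0 * (1 - s) by rewrite mulr_gt0 // subr_gt0.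
  by lra.
have [C [g [C0 gA chart]]] : exists (C : R) (g : R -> R), [/\ 0 < C,
    forall u, 0 <= u < 1 -> A (g u) &
    forall u v, 0 <= u < 1 -> 0 <= v < 1 -> `|u - v| <= C * `|g u - g v| `^ s].
  have [xpos|xneg] := ltP 0 x.
    have [C [g [C0 gI giso chart]]] :=
      isolated_chart (complex.Re p) (complex.Im p) al00 al01 s0 sal.
    exists C, g; split => // u u01; have [c [e iso]] := giso u u01.
    split; last exact: isolated_closure_neqT iso.
    apply: rX; have := gI u u01; rewrite /al0 gtr0_norm // => /andP[g1 g2].
    by rewrite ltr_norml; lra.
  have [C [g [C0 gI giso chart]]] :=
    isolated_chart (complex.Re p) (- complex.Im p) al00 al01 s0 sal.
  exists C, (fun u => - g u); split => // [u u01|u v u01 v01]; last first.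
    by rewrite -opprD normrN chart.
  have [c [e iso]] := giso u u01; split.
    apply: rX; have := gI u u01; rewrite /al0 ler0_norm // => /andP[g1 g2].
    by rewrite ltr_norml; lra.
  by apply: (@isolated_closure_neqT _ _ _ c (- e)); apply: isolatedN; rewrite !opprK.
have := holder_chart_measure_ge s0 C0 gA chart; rewrite As0 lee_fin leNgt.
by rewrite invr_gt0 mulr_gt0.
Qed.
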